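(* Let $(\Omega,\mathcal{E},P)$ be a probability space and $\mathcal{F}$ a sub-$\sigma$-algebra of $\mathcal{E}$. For each $p\in[1,+\infty]$, $(L^{p}_{\mathcal{F}}(\mathcal{E}),\mathcal{T}_c)$ is $L^0$-pre-barreled.
   Context: Notation. $L^0(\mathcal{E})$, $L^0(\mathcal{F})$ are the spaces of a.s.-equivalence classes of real-valued $\mathcal{E}$- (resp. $\mathcal{F}$-) measurable random variables; $\bar L^0_+(\mathcal{F})$ is the set of classes of $[0,+\infty]$-valued $\mathcal{F}$-measurable random variables, ordered a.s. (a complete lattice, with infimum $\bigwedge$); $L^0_+(\mathcal{F})=\{\xi\in L^0(\mathcal{F}):\xi\ge0\}$; $L^0_{++}(\mathcal{F})=\{\xi\in L^0(\mathcal{F}):\xi>0\text{ a.s.}\}$; $\tilde I_A$ is the class of the indicator of $A$. The space. Define $|||\cdot|||_p:L^0(\mathcal{E})\to\bar L^0_+(\mathcal{F})$ by $|||x|||_p=E[|x|^p\mid\mathcal{F}]^{1/p}$ for $1\le p<\infty$ (conditional expectation of a nonnegative random variable, possibly $+\infty$), and $|||x|||_\infty=\bigwedge\{\xi\in\bar L^0_+(\mathcal{F}):|x|\le\xi\}$. Put $L^p_{\mathcal{F}}(\mathcal{E})=\{x\in L^0(\mathcal{E}):|||x|||_p\in L^0_+(\mathcal{F})\}$, an $L^0(\mathcal{F})$-module on which $|||\cdot|||_p$ is an $L^0$-norm (i.e. $|||\xi x|||_p=|\xi|\,|||x|||_p$ for $\xi\in L^0(\mathcal{F})$, triangle inequality,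 and $|||x|||_p=0$ only for $x=0$). $\mathcal{T}_c$ is the translation-invariant topology with local base at $0$ given by $\{x:|||x|||_p\le\varepsilon\}$, $\varepsilon\in L^0_{++}(\mathcal{F})$. $L^0$-pre-barreled. Let $E=L^p_{\mathcal{F}}(\mathcal{E})$ and $B\subset E$. $B$ is $L^0$-balanced if $\eta B\subset B$ whenever $\eta\in L^0(\mathcal{F})$, $|\eta|\le1$; $L^0$-convex if $\xi x+(1-\xi)y\in B$ for $x,y\in B$, $\xi\in L^0(\mathcal{F})$, $0\le\xi\le1$; $L^0$-absorbent if for each $x\in E$ there is $\xi\in L^0_{++}(\mathcal{F})$ with $\eta x\in B$ for all $\eta\in L^0(\mathcal{F})$, $|\eta|\le\xi$. $B$ is an $L^0$-barrel if it is $L^0$-balanced, $L^0$-absorbent, $L^0$-convex and $\mathcal{T}_c$-closed. $B$ has the countable concatenation property if for every sequence $\{x_n\}$ in $B$ and every countable partition $\{A_n\}$ of $\Omega$ into members of $\mathcal{F}$ there is $x\in B$ with $\tilde I_{A_n}x=\tilde I_{A_n}x_n$ for all $n$. $(E,\mathcal{T}_c)$ is $L^0$-pre-barreled if every $L^0$-barrel with the countable concatenation property is a $\mathcal{T}_c$-neighborhood of $0$. *)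

(* Defs.v *)
From HB Require Import structures.
From mathcomp Require Import all_boot all_order all_algebra.
From mathcomp Require Import all_classical all_reals all_analysis.
From mathcomp Require Import measurable_realfun measurable_fun_approximation.
Set Implicit Arguments.
Unset Strict Implicit.
Unset Printing Implicit Defensive.
Import Order.TTheory GRing.Theory Num.Theory.
Import numFieldNormedType.Exports.

Local Open Scope classical_set_scope.
Local Open Scope ring_scope.
Local Open Scope quotient_scope.

Record subSigmaAlgebra d (T : measurableType d) := SubSigmaAlgebra {
  sub_events : set (set T) ;
  sub_events_sigma_algebra : sigma_algebra [set: T] sub_events ;
  sub_events_measurable : sub_events `<=` measurable }.

Definition in_sub d (T : measurableType d) (F : subSigmaAlgebra T) (A : set T) :=
  sub_events F A.
Coercion in_sub : subSigmaAlgebra >-> Funclass.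

Lemma sub_eventsT d (T : measurableType d) (F : subSigmaAlgebra T) :
  F [set: T].
Proof.
by have [F0 FC _] := sub_events_sigma_algebra F; rewrite -(setD0 setT); exact: FC.
Qed.

Section pointwise.
Context {R : realType}.

Definition abs_powR (r t : R) : \bar R := (`|t| `^ r)%:E.

Lemma measurable_abs_powR r : measurable_fun [set: R] (abs_powR r).
Proof.
apply/measurable_EFinP.
by apply: (measurableT_comp (measurable_powR r)); exact: normr_measurable.
Qed.

HB.instance Definition _ r :=
  isMeasurableFun.Build _ _ _ _ (abs_powR r) (measurable_abs_powR r).

Definition ext_powR (r : R) (t : \bar R) : \bar R := poweR t r.

Lemma measurable_ext_powR r : measurable_fun [set: \bar R] (ext_powR r).
Proof. exact: measurable_poweR. Qed.

HB.instance Definition _ r :=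
  isMeasurableFun.Build _ _ _ _ (ext_powR r) (measurable_ext_powR r).

Definition real_to_ext (t : R) : \bar R := t%:E.

Lemma measurable_real_to_ext : measurable_fun [set: R] real_to_ext.
Proof. exact/measurable_EFinP. Qed.

HB.instance Definition _ :=
  isMeasurableFun.Build _ _ _ _ real_to_ext measurable_real_to_ext.

End pointwise.

Section classes.
Context {d : measure_display} {T : measurableType d} {R : realType}.
Context (P : probability T R).

Section representatives.
Context {d2 : measure_display} {T2 : measurableType d2}.

Lemma aeEqMfun_reprK (f : {mfun T >-> T2}) :
  repr (\pi_({mfun_ P, T >-> T2}) f) = f %[ae P].
Proof.
have /eqP := reprK (\pi_({mfun_ P, T >-> T2}) f).
by rewrite eqmodE => /asboolP.
Qed.

Lemma aeEqMfun_eqP (f g : {mfun T >-> T2}) :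
  \pi_({mfun_ P, T >-> T2}) f = \pi_({mfun_ P, T >-> T2}) g <-> f = g %[ae P].
Proof.
split=> [/eqP|fg]; first by rewrite eqmodE => /asboolP.
by apply/eqP; rewrite eqmodE; apply/asboolP.
Qed.

End representatives.

Section map.
Context {d2 d3 : measure_display}.
Context {T2 : measurableType d2} {T3 : measurableType d3}.

Definition mapL0 (g : {mfun T2 >-> T3}) (x : {mfun_ P, T >-> T2}) :
  {mfun_ P, T >-> T3} := \pi_({mfun_ P, T >-> T3}) (g \o (repr x)).

Lemma mapL0_pi (g : {mfun T2 >-> T3}) (f : {mfun T >-> T2}) :
  mapL0 g (\pi_({mfun_ P, T >-> T2}) f) = \pi_({mfun_ P, T >-> T3}) (g \o f).
Proof.
rewrite /mapL0; apply/aeEqMfun_eqP; apply: filterS (aeEqMfun_reprK f) => w fw wT /=.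
by rewrite fw.
Qed.

End map.

Local Notation L0 := {mfun_ P, T >-> R}.
Local Notation Lbar0 := {mfun_ P, T >-> \bar R}.

Definition toL0 (f : {mfun T >-> R}) : L0 := \pi_({mfun_ P, T >-> R}) f.
Definition toLbar0 (f : {mfun T >-> \bar R}) : Lbar0 :=
  \pi_({mfun_ P, T >-> \bar R}) f.
Definition cstLbar0 (c : \bar R) : Lbar0 := toLbar0 (cst c).
Definition zeroLbar0 : Lbar0 := cstLbar0 0%E.

Lemma reprL0K (x : L0) : toL0 (repr x) = x.
Proof. exact: reprK. Qed.

Lemma toL0K (f : {mfun T >-> R}) : repr (toL0 f) = f %[ae P].
Proof. exact: aeEqMfun_reprK. Qed.

Lemma toL0P (f g : {mfun T >-> R}) : f = g %[ae P] -> toL0 f = toL0 g.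
Proof. by move=> fg; apply/aeEqMfun_eqP. Qed.

Lemma L0_ind (Q : L0 -> Prop) : (forall f, Q (toL0 f)) -> forall x, Q x.
Proof. by move=> Qf x; rewrite -(reprL0K x). Qed.

Definition addL0 (x y : L0) : L0 := toL0 (repr x + repr y).
Definition oppL0 (x : L0) : L0 := toL0 (- repr x).
Definition mulL0 (x y : L0) : L0 := toL0 (repr x * repr y).

Lemma addL0E f g : addL0 (toL0 f) (toL0 g) = toL0 (f + g).
Proof.
apply: toL0P; apply: filterS2 (toL0K f) (toL0K g) => w fw gw _.
change (repr (toL0 f) w + repr (toL0 g) w = f w + g w).
by rewrite fw// gw.
Qed.

Lemma oppL0E f : oppL0 (toL0 f) = toL0 (- f).
Proof.
apply: toL0P; apply: filterS (toL0K f) => w fw _.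
by change (- repr (toL0 f) w = - f w); rewrite fw.
Qed.

Lemma mulL0E f g : mulL0 (toL0 f) (toL0 g) = toL0 (f * g).
Proof.
apply: toL0P; apply: filterS2 (toL0K f) (toL0K g) => w fw gw _.
change (repr (toL0 f) w * repr (toL0 g) w = f w * g w).
by rewrite fw// gw.
Qed.

Lemma addL0A : associative addL0.
Proof.
elim/L0_ind => f; elim/L0_ind => g; elim/L0_ind => h.
by rewrite !addL0E addrA.
Qed.

Lemma addL0C : commutative addL0.
Proof. by elim/L0_ind => f; elim/L0_ind => g; rewrite !addL0E addrC. Qed.

Lemma add0L0 : left_id (toL0 0) addL0.
Proof. by elim/L0_ind => f; rewrite addL0E add0r. Qed.

Lemma addNL0 : left_inverse (toL0 0) oppL0 addL0.
Proof. by elim/L0_ind => f; rewrite oppL0E addL0E addNr. Qed.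

HB.instance Definition _ :=
  GRing.isZmodule.Build L0 addL0A addL0C add0L0 addNL0.

Lemma mulL0A : associative mulL0.
Proof.
elim/L0_ind => f; elim/L0_ind => g; elim/L0_ind => h.
by rewrite !mulL0E mulrA.
Qed.

Lemma mulL0C : commutative mulL0.
Proof. by elim/L0_ind => f; elim/L0_ind => g; rewrite !mulL0E mulrC. Qed.

Lemma mul1L0 : left_id (toL0 1) mulL0.
Proof. by elim/L0_ind => f; rewrite mulL0E mul1r. Qed.

Lemma mulL0Dl : left_distributive mulL0 +%R.
Proof.
elim/L0_ind => f; elim/L0_ind => g; elim/L0_ind => h.
have D u v : toL0 u + toL0 v = toL0 (u + v) by exact: addL0E.
by rewrite !(D, mulL0E) mulrDl.
Qed.

Lemma oneL0_neq0 : toL0 1 != 0 :> L0.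
Proof.
apply/eqP => /aeEqMfun_eqP [N [mN PN0 NP]].
have NT : N = setT.
  apply/seteqP; split=> // w _; apply: NP => /= /(_ I) e10.
  by move/eqP: (e10 : 1 = 0 :> R); rewrite oner_eq0.
by move: PN0; rewrite NT probability_setT => /eqP; rewrite onee_eq0.
Qed.

HB.instance Definition _ := GRing.Zmodule_isComNzRing.Build L0
  mulL0A mulL0C mul1L0 mulL0Dl oneL0_neq0.

Definition indL0 (A : set T) (mA : measurable A) : L0 := toL0 (mindic R mA).

Definition extL0 (x : L0) : Lbar0 := mapL0 real_to_ext x.

Definition le_as (x y : Lbar0) := \forall w \ae P, (x w <= y w)%E.

Section conditional.
Context (F : subSigmaAlgebra T).

(* A class of F-measurable variables is identified with the class, modulo
   P-almost sure equality, of measurable variables that contains it. Hence L0F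
   is a subset of L0 and acts on L0 by the product of L0. *)
Definition F_measurable d2 (T2 : measurableType d2) (x : {mfun_ P, T >-> T2}) :=
  exists2 f : T -> T2,
    measurable_fun [set: g_sigma_algebraType (sub_events F)] f & x = f %[ae P].

Definition L0F : set L0 := [set x | F_measurable x].

Definition L0F_ge0 : set L0 := [set x | L0F x /\ \forall w \ae P, 0 <= x w].

Definition L0F_gt0 : set L0 := [set x | L0F x /\ \forall w \ae P, 0 < x w].

Definition Lbar0F_ge0 : set Lbar0 :=
  [set x | F_measurable x /\ \forall w \ae P, (0 <= x w)%E].

Definition is_condE (x y : Lbar0) := Lbar0F_ge0 y /\
  forall A, F A -> (\int[P]_(w in A) y w = \int[P]_(w in A) x w)%E.

(* For a nonnegative x, is_condE x has exactly one solution (possibly taking the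
   value +oo), so that the default value of xget is irrelevant. *)
Definition condE (x : Lbar0) : Lbar0 :=
  xget (cstLbar0 +oo%E) [set y | is_condE x y].

Definition is_infimum (S : set Lbar0) (z : Lbar0) :=
  [/\ Lbar0F_ge0 z, (forall x, S x -> le_as z x) &
      forall y, Lbar0F_ge0 y -> (forall x, S x -> le_as y x) -> le_as y z].

(* Lbar0F_ge0 is a complete lattice for le_as, so that the default value of xget
   is irrelevant when S is a subset of it. *)
Definition infimumLbar0 (S : set Lbar0) : Lbar0 :=
  xget (cstLbar0 +oo%E) [set z | is_infimum S z].

(* The last branch is meant for p = +oo; p = -oo is excluded by 1 <= p. *)
Definition condnorm (p : \bar R) (x : L0) : Lbar0 :=
  match p with
  | r%:E => mapL0 (ext_powR r^-1) (condE (mapL0 (abs_powR r) x))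
  | _ => infimumLbar0
      [set xi | Lbar0F_ge0 xi /\ \forall w \ae P, (`|x w|%:E <= xi w)%E]
  end%E.

Definition condLp (p : \bar R) : set L0 :=
  [set x | exists2 xi, L0F_ge0 xi & condnorm p x = extL0 xi].

Lemma L0F_gt0_one : L0F_gt0 1.
Proof.
have e1 : (1 : L0) = (fun=> 1) %[ae P] := toL0K 1.
split; first by exists (fun=> 1) => //; exact: measurable_cst.
by apply: filterS e1 => w e1; change (0 < (1 : L0) w); rewrite e1// ltr01.
Qed.

Lemma L0F_gt0_min e1 e2 : L0F_gt0 e1 -> L0F_gt0 e2 ->
  exists2 e, L0F_gt0 e & \forall w \ae P, e w <= e1 w /\ e w <= e2 w.
Proof.
move=> [[f1 mf1 ef1] e1_gt0] [[f2 mf2 ef2] e2_gt0].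
pose m : {mfun T >-> R} := repr e1 \min repr e2.
have em : toL0 m = (fun w => Num.min (e1 w) (e2 w)) %[ae P] := toL0K m.
exists (toL0 m).
  split; last first.
    apply: filterS3 em e1_gt0 e2_gt0 => w emw e1w e2w.
    by change (0 < toL0 m w); rewrite emw// lt_min e1w.
  exists (f1 \min f2); first exact: measurable_minr.
  apply: filterS3 em ef1 ef2 => w emw e1w e2w wT.
  have {}e1w : e1 w = f1 w := e1w wT.
  have {}e2w : e2 w = f2 w := e2w wT.
  have {}emw : toL0 m w = Num.min (e1 w) (e2 w) := emw wT.
  by rewrite [LHS]emw e1w e2w.
by apply: filterS em => w ->//; rewrite !ge_min !lexx orbT.
Qed.

Lemma ext_le_as (x : Lbar0) (e1 e2 : L0) : le_as x (extL0 e1) ->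
  (\forall w \ae P, e1 w <= e2 w) -> le_as x (extL0 e2).
Proof.
have E e : extL0 e = (fun w => (e w)%:E) %[ae P] := aeEqMfun_reprK _.
move=> xe1 e12; rewrite /le_as.
have le_e12 : \forall w \ae P,
    extL0 e1 w = (e1 w)%:E /\ extL0 e2 w = (e2 w)%:E.
  by apply: filterS2 (E e1) (E e2) => w /(_ I) ? /(_ I) ?.
apply: filterS3 le_e12 xe1 e12 => w [e1w e2w] xe1 e12.
by rewrite e2w; apply: le_trans xe1 _; rewrite e1w lee_fin.
Qed.

Lemma toLbar0P (f g : {mfun T >-> \bar R}) :
  f = g %[ae P] -> toLbar0 f = toLbar0 g.
Proof. by move=> fg; apply/aeEqMfun_eqP. Qed.

Lemma toLbar0_0E : \forall w \ae P, zeroLbar0 w = 0%E.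
Proof.
have := aeEqMfun_reprK (cst (0%E : \bar R) : {mfun T >-> \bar R}).
by apply: filterS => w /(_ I).
Qed.

Lemma L0_0E : \forall w \ae P, (0 : L0) w = 0.
Proof. by have := toL0K 0; apply: filterS => w /(_ I). Qed.

Lemma Lbar0F_ge0_0 : Lbar0F_ge0 zeroLbar0.
Proof.
have e0 := toLbar0_0E.
split; first by exists (cst 0%E); [exact: measurable_cst|exact: aeEqMfun_reprK].
by apply: filterS e0 => w ->.
Qed.

Lemma condE0 : condE zeroLbar0 = zeroLbar0.
Proof.
have e0 := toLbar0_0E.
suff uniq_y (y : Lbar0) : is_condE zeroLbar0 y -> y = zeroLbar0.
  by apply: xget_unique => //; split => //; exact: Lbar0F_ge0_0.
move=> [[_ y0] yint].
have my (z : Lbar0) : measurable_fun setT z by exact: measurable_funPT.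
have int0 : (\int[P]_w zeroLbar0 w = 0)%E.
  rewrite (ae_eq_integral (cst 0%E))//; first exact: integral0.
  by apply: filterS e0.
have yz : (y : T -> _) = cst 0%E %[ae P].
  apply/ae_eq_integral_abs => //.
  rewrite -int0 -(yint _ (sub_eventsT F)).
  apply: ae_eq_integral => //; first exact: measurableT_comp.
  by apply: filterS y0 => w yw _; rewrite gee0_abs.
rewrite -[y]reprK; exact: toLbar0P.
Qed.

Lemma condLp0 p : (1 <= p)%E -> condLp p 0.
Proof.
have e0 := toLbar0_0E.
have z0 := L0_0E.
move=> p1; exists 0.
  split; first by exists (cst 0); [exact: measurable_cst|exact: aeEqMfun_reprK].
  by apply: filterS z0 => w ->.
have -> : extL0 0 = zeroLbar0.
  by rewrite /extL0 mapL0_pi; exact: toLbar0P (aeW _ _).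
case: p p1 => [r| |]//= r1.
  have r0 : r != 0 by rewrite gt_eqF// (lt_le_trans ltr01)// -lee_fin.
  rewrite /condnorm mapL0_pi.
  have -> : \pi_({mfun_ P, T >-> \bar R}) (abs_powR r \o (0 : {mfun T >-> R}))
      = zeroLbar0.
    apply: toLbar0P; apply: aeW => w _ /=.
    by rewrite /abs_powR /= normr0 powR0.
  rewrite condE0 mapL0_pi; apply: toLbar0P; apply: aeW => w _ /=.
  by apply: poweR0r; rewrite invr_neq0.
set S := (X in infimumLbar0 X).
suff uniq_y (y : Lbar0) : is_infimum S y -> y = zeroLbar0.
  apply: xget_unique => //; split; first exact: Lbar0F_ge0_0.
    by move=> x [[_ x0] _]; apply: filterS2 e0 x0 => w ->.
  move=> y [_ _]; apply.
  split; first exact: Lbar0F_ge0_0.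
  by apply: filterS2 e0 z0 => w -> ->; rewrite normr0.
move=> [[_ y0] yle yge].
rewrite -[y]reprK; apply: toLbar0P.
have : le_as y zeroLbar0.
  apply: yle; split; first exact: Lbar0F_ge0_0.
  by apply: filterS2 e0 z0 => w -> ->; rewrite normr0.
move=> y_le0; apply: filterS3 e0 y0 y_le0 => w e0w yw.
by rewrite e0w => yw' _; apply/eqP; rewrite eq_le; apply/andP; split.
Qed.

End conditional.

Section topology.
Context (F : subSigmaAlgebra T) (p : \bar R) (p1 : (1 <= p)%E).

Definition LpType of (1 <= p)%E : Type := {x : L0 | x \in condLp F p}.
HB.instance Definition _ := Choice.on (LpType p1).

Implicit Types (x y : LpType p1) (U : set (LpType p1)).

Definition Lp_val x : L0 := val x.

Definition Lp0 : LpType p1 := exist _ 0 (mem_set (condLp0 F p1)).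

Definition Tc_ball x (e : L0) : set (LpType p1) :=
  [set y | le_as (condnorm F p (Lp_val y - Lp_val x)) (extL0 e)].

(* The topology is given by its open sets: those that contain, around each of
   their points x, a translate x + {z | |||z|||_p <= e} of a set of the local
   base at 0. *)
Definition Tc_open U :=
  forall x, U x -> exists2 e, L0F_gt0 F e & Tc_ball x e `<=` U.

Lemma Tc_openT : Tc_open setT.
Proof. by move=> x _; exists 1 => //; exact: L0F_gt0_one. Qed.

Lemma Tc_openI : setI_closed Tc_open.
Proof.
move=> U V oU oV x [/oU[e1 e1_gt0 e1U] /oV[e2 e2_gt0 e2V]].
have [e e_gt0 le_e] := L0F_gt0_min e1_gt0 e2_gt0.
exists e => // y xy; split; [apply: e1U|apply: e2V]; apply: ext_le_as xy _.
  by apply: filterS le_e => w [].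
by apply: filterS le_e => w [].
Qed.

Lemma Tc_open_bigU (I : Type) (f : I -> set (LpType p1)) :
  (forall i, Tc_open (f i)) -> Tc_open (\bigcup_i f i).
Proof.
move=> of_ x [i _ /of_[e e_gt0 eU]]; exists e => // y /eU fy; by exists i.
Qed.

HB.instance Definition _ :=
  isOpenTopological.Build (LpType p1) Tc_openT Tc_openI Tc_open_bigU.

End topology.

Section pre_barreled.
Context (F : subSigmaAlgebra T) (p : \bar R) (p1 : (1 <= p)%E).
(* B is meant to be a subset of condLp F p. *)
Implicit Type B : set L0.

Definition L0_balanced B := forall eta x, L0F F eta ->
  (\forall w \ae P, `|eta w| <= 1) -> B x -> B (eta * x).

Definition L0_convex B := forall xi x y, L0F F xi ->
  (\forall w \ae P, 0 <= xi w <= 1) -> B x -> B y ->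
  B (xi * x + (1 - xi) * y).

Definition L0_absorbent B := forall x, condLp F p x ->
  exists2 xi, L0F_gt0 F xi &
    forall eta, L0F F eta -> (\forall w \ae P, `|eta w| <= xi w) -> B (eta * x).

Definition Lp_trace B : set (LpType F p1) := [set x | B (Lp_val x)].

Definition L0_barrel B := [/\ L0_balanced B, L0_absorbent B, L0_convex B &
  closed (Lp_trace B)].

(* Blocks of a partition may be empty, so that finite ones are included. *)
Definition countable_concatenation B :=
  forall (x : nat -> L0) (A : nat -> set T) (FA : forall n, F (A n)),
  (forall n, B (x n)) -> trivIset [set: nat] A -> \bigcup_n A n = [set: T] ->
  exists2 y, B y & forall n,
    indL0 (sub_events_measurable (FA n)) * y =
    indL0 (sub_events_measurable (FA n)) * x n.

Definition L0_pre_barreled := forall B, B `<=` condLp F p -> L0_barrel B ->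
  countable_concatenation B -> nbhs (Lp0 F p1) (Lp_trace B).

End pre_barreled.
End classes.

(* Main.v *)
From HB Require Import structures.
Require Import Defs.
From mathcomp Require Import all_boot all_order all_algebra.
From mathcomp Require Import all_classical all_reals all_analysis.
From mathcomp Require Import measurable_realfun measurable_fun_approximation.
From mathcomp Require Import ring lra.

(** For p finite, |||x|||_p <= e amounts to E[1_A |x|^p] <= E[1_A e^p] for all A
    in F, and for p = +oo to |x| <= e; both descriptions are compatible with
    gluing along countable F-partitions.  Hence, by exhaustion, a property of
    F-measurable sets that is stable under gluing holds on a set D as soon as
    every subset of D of positive measure contains one on which it holds.

    Let B be a barrel with the countable concatenation property that absorbs no
    ball over Omega.  By exhaustion there is H of positive measure such that B
    absorbs no ball over any subset of H of positive measure.  Given a ball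
    around x and n, some x + y and x - y in it cannot both have their
    restrictions in nB, for otherwise y would have it; since B is closed,
    exhaustion yields a smaller ball all of whose elements are nowhere in nB on
    H.  The nested balls have a common point z, by completeness, and z is nowhere
    in any nB on H, contrary to the fact that B absorbs z. *)

Set Implicit Arguments.
Unset Strict Implicit.
Unset Printing Implicit Defensive.
Import Order.TTheory GRing.Theory Num.Theory.
Import numFieldNormedType.Exports.

Local Open Scope classical_set_scope.
Local Open Scope ring_scope.

(** * Sub-sigma-algebras and gluing *)

Section sub_sigma_algebra.
Context {d : measure_display} {T : measurableType d} (F : subSigmaAlgebra T).

(** In general [T_c] has no countable base at 0, and [B] absorbs a point [z] only up to a random
    factor [xi], which may be arbitrarily small on parts of H. So [z] need not belong to any nB over
    the whole of H; it only does so over the sets where [xi] is at least 1/n, one of which meets H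
    in positive measure. This is why absence from nB is required on every F-subset of H of positive
    measure. This form of absence also passes to subsets, as exhaustion demands, whereas plain
    absence over H does not. The set H itself has to be found because [B] may well absorb a ball
    over a part of Omega.

    The radii are random variables as well. They are chosen decreasing, and the n-th step is bounded
    by the fraction 1 / 4 ^ n.+1 of the current radius. The increments are then summable almost
    surely, and the pointwise limit stays in every ball. The powers of 4, where powers of 2 would be
    expected, are the price of a triangle inequality for series that does without Minkowski. *)

Definition subT := g_sigma_algebraType (sub_events F).

Lemma subTE (A : set T) : measurable (A : set subT) = F A.
Proof.
by rewrite -[LHS]/(<<s sub_events F>> A) sigma_algebra_id//; exact:
  sub_events_sigma_algebra.
Qed.

Lemma sub_measurable (A : set T) : F A -> measurable A.
Proof. exact: sub_events_measurable. Qed.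

Lemma subC (A : set T) : F A -> F (~` A).
Proof. by rewrite -!subTE; exact: measurableC. Qed.

Lemma subI (A B : set T) : F A -> F B -> F (A `&` B).
Proof. by rewrite -!subTE; exact: measurableI. Qed.

Lemma subU (A B : set T) : F A -> F B -> F (A `|` B).
Proof. by rewrite -!subTE; exact: measurableU. Qed.

Lemma subD (A B : set T) : F A -> F B -> F (A `\` B).
Proof. by rewrite -!subTE; exact: measurableD. Qed.

Lemma sub0 : F set0.
Proof. by rewrite -subTE; exact: measurable0. Qed.

Lemma sub_bigcup (A : nat -> set T) : (forall n, F (A n)) -> F (\bigcup_n A n).
Proof. by move=> FA; rewrite -subTE; apply: bigcupT_measurable => n;
  rewrite subTE. Qed.

Lemma sub_measurable_fun d2 (T2 : measurableType d2) (f : T -> T2) :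
  measurable_fun [set: subT] f -> measurable_fun [set: T] f.
Proof.
move=> mf _ Y mY; rewrite setTI; apply: sub_measurable.
by rewrite -subTE -[X in measurable X]setTI; exact: mf.
Qed.

(* A countable partition of [T] into members of [F] is encoded by the map
   sending a point to the index of its block. *)
Definition sub_index (N : T -> nat) := forall n, F (N @^-1` [set n]).

Lemma sub_index_bool (A : set T) : F A -> sub_index (fun w => w \in A).
Proof.
move=> FA [|[|n]].
- rewrite (_ : _ @^-1` _ = ~` A); first exact: subC.
  by apply/seteqP; split => w /=; case: (boolP (w \in A)) =>
    [/set_mem|/negP nA] // _; apply: contra_not nA; exact: mem_set.
- rewrite (_ : _ @^-1` _ = A)//.
  by apply/seteqP; split => w /=; case: (boolP (w \in A)) =>
    [/set_mem|/negP nA] // /mem_set/nA.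
- rewrite (_ : _ @^-1` _ = set0); first exact: sub0.
  by apply/seteqP; split => w //=; case: (w \in A).
Qed.

(** Disjointification: [N w] is one more than the first index whose set contains [w], and 0 is kept
    for the points outside the union. *)
Lemma exists_sub_index (A : nat -> set T) : (forall n, F (A n)) ->
  exists2 N, sub_index N &
    (forall n, N @^-1` [set n.+1] `<=` A n) /\
    ~` (N @^-1` [set 0%N]) = \bigcup_n A n.
Proof.
move=> FA.
pose Q n := [pred w | w \in A n].
have ex w : (\bigcup_n A n) w -> exists n, w \in A n.
  by move=> [n _ Anw]; exists n; rewrite inE.
pose N w := if pselect ((\bigcup_n A n) w) is left h then (ex_minn (ex w h)).+1
  else 0%N.
have NP w n : N w = n.+1 <-> seqDU A n w.
  rewrite /N /seqDU; case: pselect => [h|h]; last first.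
    by split => // -[Anw _]; exfalso; apply: h; exists n.
  case: ex_minnP => m /[!inE] Am minm; split => [[<-]|[Anw nAn]].
    by split => //; rewrite -bigcup_mkord => -[k /= km Akw]; move: (minm k);
      rewrite inE => /(_ Akw); rewrite leqNgt km.
  congr _.+1; apply/eqP; rewrite eqn_leq minm ?inE//= leqNgt; apply/negP => mn.
  by apply: nAn; rewrite -bigcup_mkord; exists m.
have N0 : ~` (N @^-1` [set 0%N]) = \bigcup_n A n.
  apply/seteqP; split => w /=; rewrite /N; case: pselect => //.
have NS n : N @^-1` [set n.+1] = seqDU A n.
  by apply/seteqP; split => w /NP.
exists N.
  case=> [|n]; first by rewrite -[_ @^-1` _]setCK N0; exact/subC/sub_bigcup.
  rewrite NS -subTE; apply: measurableD; first by rewrite subTE.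
  by apply: bigsetU_measurable => i _; rewrite subTE.
by split => // n; rewrite NS; exact: subset_seqDU.
Qed.

End sub_sigma_algebra.

Lemma measurable_glue d1 (T1 : measurableType d1) d2 (T2 : measurableType d2)
    (N : T1 -> nat) (f : nat -> T1 -> T2) :
  (forall n, measurable (N @^-1` [set n])) ->
  (forall n, measurable_fun [set: T1] (f n)) ->
  measurable_fun [set: T1] (fun w => f (N w) w).
Proof.
move=> mN mf _ Y mY; rewrite setTI.
rewrite (_ : _ @^-1` _ = \bigcup_n (N @^-1` [set n] `&` f n @^-1` Y)).
  apply: bigcupT_measurable => n; apply: measurableI => //.
  by rewrite -[X in measurable X]setTI; exact: mf.
by apply/seteqP; split => [w Yw|w [n _ [<-]]]//; exists (N w).
Qed.

(** * Classes prescribed pointwise *)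

Section L0_functions.
Context {d : measure_display} {T : measurableType d} {R : realType}.
Context (P : probability T R) (F : subSigmaAlgebra T).
Local Notation L0 := {mfun_ P, T >-> R}.

(* Zero when [f] is not measurable. *)
Definition L0_of (f : T -> R) : L0 :=
  match pselect (measurable_fun [set: T] f) with
  | left mf => toL0 P (mfun_Sub (mem_set mf))
  | right _ => 0
  end.

Lemma L0_ofE (f : T -> R) : measurable_fun [set: T] f ->
  \forall w \ae P, L0_of f w = f w.
Proof.
move=> mf; rewrite /L0_of; case: pselect => // mf'.
by apply: filterS (toL0K P (mfun_Sub (mem_set mf'))) => w /(_ I).
Qed.

Lemma L0_ae (x y : L0) : (\forall w \ae P, x w = y w) -> x = y.
Proof.
move=> xy; rewrite -(reprL0K x) -(reprL0K y).
by apply: toL0P; apply: filterS xy => w + _.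
Qed.

Lemma addL0_ae (x y : L0) : \forall w \ae P, (x + y : L0) w = x w + y w.
Proof.
have := toL0K P (repr x + repr y).
by apply: filterS => w /(_ I).
Qed.

Lemma oppL0_ae (x : L0) : \forall w \ae P, (- x : L0) w = - x w.
Proof.
have := toL0K P (- repr x).
by apply: filterS => w /(_ I).
Qed.

Lemma subL0_ae (x y : L0) : \forall w \ae P, (x - y : L0) w = x w - y w.
Proof. by apply: filterS2 (addL0_ae x (- y)) (oppL0_ae y) => w -> ->. Qed.

Lemma mulL0_ae (x y : L0) : \forall w \ae P, (x * y : L0) w = x w * y w.
Proof.
have := toL0K P (repr x * repr y).
by apply: filterS => w /(_ I).
Qed.

Lemma oneL0_ae : \forall w \ae P, (1 : L0) w = 1.
Proof. by apply: filterS (toL0K P 1) => w /(_ I). Qed.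

Lemma indL0_ae (A : set T) (mA : measurable A) :
  \forall w \ae P, indL0 P mA w = \1_A w.
Proof. by apply: filterS (toL0K P (mindic R mA)) => w /(_ I). Qed.

Lemma measurable_L0 (x : L0) : measurable_fun [set: T] x.
Proof. exact: measurable_funPT. Qed.

Definition glueL0 (N : T -> nat) (u : nat -> L0) : L0 :=
  L0_of (fun w => u (N w) w).

Lemma glueL0E N u : sub_index F N -> \forall w \ae P, glueL0 N u w = u (N w) w.
Proof.
move=> FN; apply: L0_ofE.
apply: (@measurable_glue _ _ _ _ N (fun n => u n : T -> R)) => n.
  exact: sub_measurable (FN n).
exact: measurable_L0.
Qed.

Definition restrL0 (A : set T) (x : L0) : L0 := L0_of (fun w => \1_A w * x w).

Lemma restrL0E A x : F A -> \forall w \ae P, restrL0 A x w = \1_A w * x w.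
Proof.
move=> FA; apply: L0_ofE; apply: measurable_funM; last exact: measurable_L0.
exact/measurable_indic/sub_measurable/FA.
Qed.

Definition scaleL0 (c : R) (x : L0) : L0 := L0_of (fun w => c * x w).

Lemma scaleL0E c x : \forall w \ae P, scaleL0 c x w = c * x w.
Proof. by apply: L0_ofE; apply: measurable_funM => //; exact: measurable_L0.
  Qed.

Lemma F_measurable_L0_of (f : T -> R) : measurable_fun [set: subT F] f ->
  L0F F (L0_of f).
Proof.
move=> mf; exists f => //.
by apply: filterS (L0_ofE (sub_measurable_fun mf)) => w.
Qed.

Lemma L0F_cst (c : R) : L0F F (L0_of (cst c)).
Proof. exact: F_measurable_L0_of. Qed.

Lemma L0F_rep (x : L0) : L0F F x ->
  exists2 f : T -> R, measurable_fun [set: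
    subT F] f & \forall w \ae P, x w = f w.
Proof. by move=> [f mf xf]; exists f => //; apply: filterS xf => w; exact. Qed.

End L0_functions.

(** * Conditional expectation of nonnegative functions *)

Section restriction.
Local Open Scope ereal_scope.
Context {d : measure_display} {T : measurableType d} {R : realType}.
Context (F : subSigmaAlgebra T).

Lemma sub_semi_sigma_additive (m : set T -> \bar R) :
  semi_sigma_additive m -> semi_sigma_additive (m : set (subT F) -> \bar R).
Proof.
move=> madd A mA tA mUA; apply: madd => //.
  by move=> n; apply: (@sub_measurable _ _ F); rewrite -subTE.
by apply: (@sub_measurable _ _ F); rewrite -subTE.
Qed.

Section measure.
Context (P : probability T R).

(** Radon-Nikodym is applied to the restriction of [P] to F, on [subT F], so that the density comes
    out F-measurable. *)
Definition subP : set (subT F) -> \bar R := P.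

Let subP0 : subP set0 = 0. Proof. exact: measure0. Qed.

Let subP_ge0 A : 0 <= subP A. Proof. exact: measure_ge0. Qed.

Let subP_additive : semi_sigma_additive subP.
Proof. exact/sub_semi_sigma_additive/measure_semi_sigma_additive. Qed.

HB.instance Definition _ :=
  isMeasure.Build _ _ _ subP subP0 subP_ge0 subP_additive.

Let subP_finite : fin_num_fun subP.
Proof. by move=> A; rewrite subTE => /sub_measurable; exact: fin_num_measure.
  Qed.

HB.instance Definition _ := Measure_isFinite.Build _ _ _ subP subP_finite.

(** [subP] is the image of [P] under the identity from [T] to [subT F], which is measurable because
    F consists of events. *)
Lemma ge0_integral_subP (f : T -> \bar R) (A : set T) :
  measurable_fun [set: subT F] f -> (forall w, 0 <= f w) -> F A ->
  \int[subP]_(w in A) f w = \int[P]_(w in A) f w.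
Proof.
move=> mf f0 FA.
have mid : measurable_fun [set: T] (idfun : T -> subT F).
  by apply: (@sub_measurable_fun _ T F _ (subT F) idfun); exact: measurable_id.
rewrite -[RHS](@ge0_integral_pushforward _ _ _ (subT F) _ _ mid P A f) => //.
- by rewrite subTE.
- exact: measurable_funTS.
Qed.

End measure.
End restriction.

Lemma ae_notin d (T : measurableType d) (R : realType)
    (P : probability T R) (C : set T) :
  measurable C -> P C = 0%E -> \forall w \ae P, ~ C w.
Proof. by move=> mC PC; exists C; split => // w /= /contrapT. Qed.

Lemma notin_ae d (T : measurableType d) (R : realType)
    (P : probability T R) (C : set T) :
  measurable C -> (\forall w \ae P, ~ C w) -> P C = 0%E.
Proof.
move=> mC nC; apply/negligibleP => //.
by apply: negligibleS nC => w Cw; exact.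
Qed.

Section conditional_expectation.
Local Open Scope ereal_scope.
Context {d : measure_display} {T : measurableType d} {R : realType}.
Context (P : probability T R) (F : subSigmaAlgebra T).

Lemma integral_partition (N : T -> nat) (u : T -> \bar R) (A : set T) :
  sub_index F N -> measurable_fun [set: T] u -> (forall w, 0 <= u w) -> F A ->
  \int[P]_(w in A) u w =
  \sum_(n <oo) \int[P]_(w in A `&` N @^-1` [set n]) u w.
Proof.
move=> FN mu u0 FA.
have -> : A = \bigcup_n (A `&` N @^-1` [set n]).
  by apply/seteqP; split => [w Aw|w [n _ []]]//; exists (N w).
rewrite ge0_integral_bigcup//.
- apply: eq_eseriesr => n _; congr (integral _ _ _).
  apply/seteqP; split => [w [Aw Nw]|w [[m _ []]]]//.
  by split => //; exists n.
- by move=> n; apply: sub_measurable (subI FA (FN n)).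
- exact: measurable_funTS.
- by apply/trivIsetP => i j _ _ ij; rewrite -subset0 =>
  w [[_ /= Ni] [_ /= Nj]]; move: ij; rewrite -Ni Nj eqxx.
Qed.

Section finite.
Context (u : T -> \bar R) (mu : measurable_fun [set: T] u).
Context (u0 : forall w, 0 <= u w) (ufin : \int[P]_w u w < +oo).

Definition density_measure : set (subT F) -> \bar R :=
  fun A => \int[P]_(w in A) u w.

Let dens0 : density_measure set0 = 0. Proof. exact: integral_set0. Qed.

Let dens_ge0 A : 0 <= density_measure A. Proof. exact: integral_ge0. Qed.

Let dens_additive : semi_sigma_additive density_measure.
Proof. exact/sub_semi_sigma_additive/semi_sigma_additive_nng_induced. Qed.

HB.instance Definition _ :=
  isMeasure.Build _ _ _ density_measure dens0 dens_ge0 dens_additive.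

Let dens_finite : fin_num_fun density_measure.
Proof.
move=> A; rewrite subTE => /sub_measurable mA; rewrite ge0_fin_numE//.
by apply: le_lt_trans ufin; apply: ge0_subset_integral.
Qed.

HB.instance Definition _ := Measure_isFinite.Build _ _ _ density_measure
  dens_finite.

(** The density with respect to [subP] of the finite measure with density [u], restricted to F. *)
Lemma condexp_finite : exists y : T -> \bar R,
  [/\ measurable_fun [set: subT F] y, forall w, 0 <= y w &
   forall A, F A -> \int[P]_(w in A) y w = \int[P]_(w in A) u w].
Proof.
have abs : density_measure `<< @subP _ _ _ F P.
  apply/null_content_dominatesP => A; rewrite subTE => FA PA.
  by apply: null_set_integral => //; [exact: sub_measurable FA|exact:
    measurable_funTS].
have [y [y0 _ /(measurable_int _) my yE]] :=
  @radon_nikodym_sigma_finite _ (subT F) R (@subP _ _ _ F P) density_measure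
    abs.
exists y; split => // A FA.
by rewrite -ge0_integral_subP// -yE// subTE.
Qed.

End finite.

(** Integrability on each block of an F-partition is enough: the densities obtained block by block
    are glued. *)
Lemma condexp_exists (N : T -> nat) (u : T -> \bar R) :
  sub_index F N -> measurable_fun [set: T] u -> (forall w, 0 <= u w) ->
  (forall n, \int[P]_(w in N @^-1` [set n]) u w < +oo) ->
  exists y : T -> \bar R,
  [/\ measurable_fun [set: subT F] y, forall w, 0 <= y w &
   forall A, F A -> \int[P]_(w in A) y w = \int[P]_(w in A) u w].
Proof.
move=> FN mu u0 ufin.
pose un n := u \_ (N @^-1` [set n]).
have mN n : measurable (N @^-1` [set n]) by exact: sub_measurable (FN n).
have mun n : measurable_fun setT (un n).
  by apply/(measurable_restrictT _ _).1 => //; exact: measurable_funTS.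
have un0 n w : 0 <= un n w by rewrite /un patchE; case: ifP.
have unfin n : \int[P]_w un n w < +oo by rewrite /un -integral_mkcond.
have /choice[y yP] n := condexp_finite (mun n) (un0 n) (unfin n).
have my : measurable_fun [set: subT F] (fun w => y (N w) w).
  apply: (@measurable_glue _ (subT F) _ _ N y) => n; last by case: (yP n).
  by rewrite subTE; exact: FN.
exists (fun w => y (N w) w); split => //.
  by move=> w; case: (yP (N w)).
move=> A FA; rewrite !(integral_partition FN) //; first last.
- by move=> w; case: (yP (N w)).
- exact: sub_measurable_fun my.
apply: eq_eseriesr => n _.
have [_ _ yn] := yP n.
transitivity (\int[P]_(w in A `&` N @^-1` [set n]) y n w).
  by apply: eq_integral => w /[!inE] -[_ /= ->].
rewrite yn; last exact: subI.
by apply: eq_integral => w /[!inE] -[_ /= Nw]; rewrite /un patchE mem_set.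
Qed.

Lemma cond_le_ae (y : T -> \bar R) (v : T -> R) :
  measurable_fun [set: subT F] y -> (forall w, 0 <= y w) ->
  measurable_fun [set: subT F] v -> (forall w, (0 <= v w)%R) ->
  (forall A, F A -> \int[P]_(w in A) y w <= \int[P]_(w in A) (v w)%:E) ->
  \forall w \ae P, y w <= (v w)%:E.
Proof.
move=> my y0 mv v0 yv.
(* The bound [v <= n] makes the integral of [v] over [C n] finite, so that it can be cancelled; the
   gap 1 / n.+1 then forces [P (C n) = 0]. Almost every point where [v < y] is in some [C n]. *)
pose C (n : nat) := [set w | (v w + n.+1%:R^-1)%:E <= y w] `&` [set w | (v w <=
  n%:R)%R].
have FC n : F (C n).
  rewrite -subTE -[X in measurable X]setTI setIIr; apply: measurableI.
    apply: measurable_lee => //; apply/measurable_EFinP.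
    exact: measurable_funD.
  exact: measurable_fun_le.
have mC n := sub_measurable (FC n).
have mvT : measurable_fun [set: T] (EFin \o v).
  by apply/measurable_EFinP; exact: sub_measurable_fun mv.
have PC n : P (C n) = 0.
  have mvn : measurable_fun (C n) (EFin \o v) by exact: measurable_funTS.
  have h : \int[P]_(w in C n) (v w)%:E + (n.+1%:R^-1)%:E * P (C n) <=
      \int[P]_(w in C n) (v w)%:E.
    have v0' w : C n w -> 0 <= (v w)%:E by rewrite lee_fin.
    have E : \int[P]_(w in C n) ((v w)%:E + (n.+1%:R^-1)%:E) =
        \int[P]_(w in C n) (v w)%:E + (n.+1%:R^-1)%:E * P (C n).
      by rewrite ge0_integralD// ?integral_cst// => w _; rewrite lee_fin.
    rewrite -E.
    apply: le_trans (yv _ (FC n)); apply: ge0_le_integral => //.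
    - by move=> w _; rewrite adde_ge0 ?lee_fin.
    - by apply: emeasurable_funD => //; exact: measurable_cst.
    - by apply: measurable_funTS; exact: (sub_measurable_fun my).
    - by move=> w [].
  have fin : \int[P]_(w in C n) (v w)%:E \is a fin_num.
    rewrite ge0_fin_numE; last by apply: integral_ge0 => w _; rewrite lee_fin.
    apply: (@le_lt_trans _ _ (\int[P]_(w in C n) (n%:R)%:E)).
      apply: ge0_le_integral => //; try by move=> w _; rewrite lee_fin.
      by move=> w [_ /=]; rewrite lee_fin.
    by rewrite integral_cst// ltey_eq fin_numM// fin_num_measure.
  apply/eqP; rewrite eq_le measure_ge0 andbT.
  have : (n.+1%:R^-1)%:E * P (C n) <= 0.
    by rewrite -(leeD2lE _ _ fin) adde0.
  by rewrite pmule_rle0// lte_fin invr_gt0.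
have : \forall w \ae P, forall n, ~ C n w.
  by apply: ae_foralln => n; exact: ae_notin (mC n) (PC n).
apply: filterS => w nC.
rewrite leNgt; apply/negP => vy.
have [k vk] : exists k, (v w + k.+1%:R^-1)%:E <= y w.
  case: (y w) vy => [r|_|//]; last by exists 0%N; rewrite leey.
  by rewrite lte_fin => /ltr_add_invr[k /ltW]; exists k.
pose m := Num.bound (v w).
apply: (nC (maxn k m)); split => /=.
  apply: le_trans vk; rewrite lee_fin lerD2l lef_pV2 ?posrE//.
  by rewrite ler_nat ltnS leq_maxl.
apply: (@le_trans _ _ m%:R); first exact/ltW/archi_boundP.
by rewrite ler_nat leq_maxr.
Qed.

End conditional_expectation.

(** * Exhaustion *)

Section exhaustion.
Context {d : measure_display} {T : measurableType d} {R : realType}.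
Context (P : probability T R) (F : subSigmaAlgebra T).
Implicit Types (Q : set (set T)) (A D : set T).

(** The union [M] of a maximizing sequence attains the supremum of the measures of the sets in [Q].
    A set of [Q] that left [M] by positive measure would, joined to [M], exceed this supremum. *)
Lemma exhaustion Q : Q set0 ->
  (forall A : nat -> set T, (forall n, F (A n)) -> (forall n, Q (A n)) ->
    Q (\bigcup_n A n)) ->
  exists M, [/\ F M, Q M & forall A, F A -> Q A -> P (A `\` M) = 0%E].
Proof.
move=> Q0 QU.
pose S := [set fine (P A) | A in [set A | F A /\ Q A]].
have S1 : ubound S 1.
  move=> _ [A [FA _] <-]; have mA := sub_measurable FA.
  by rewrite -lee_fin fineK ?probability_le1// fin_num_measure.
have hS : has_sup S.
  by split; [exists (fine (P set0)), set0 => //; split => //; exact: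
    sub0|exists 1].
have /choice[A AP] n : exists A, [/\ F A, Q A & sup S - n.+1%:R^-1 < fine (P
  A)].
  have n0 : 0 < n.+1%:R^-1 :> R by rewrite invr_gt0.
  by have [_ [A [FA QA] <-] SA] := sup_adherent n0 hS; exists A.
have FA n : F (A n) by case: (AP n).
have QA n : Q (A n) by case: (AP n).
have FM : F (\bigcup_n A n) := sub_bigcup FA.
have SM : sup S <= fine (P (\bigcup_n A n)).
  rewrite leNgt; apply/negP => /ltr_add_invr[n].
  apply/negP; rewrite -leNgt -lerBlDr; have [_ _ /ltW AS] := AP n.
  have mAn := sub_measurable (FA n); have mM := sub_measurable FM.
  apply: le_trans AS _; rewrite fine_le ?fin_num_measure//.
  by apply: le_measure; rewrite ?inE//; exact: bigcup_sup.
exists (\bigcup_n A n); split => // [|B FB QB]; first exact: QU.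
set M := \bigcup_n A n in FM SM *.
have FBM : F (B `\` M) by exact: subD.
have mBM := sub_measurable FBM.
have mM := sub_measurable FM.
have QMB : Q (M `|` B).
  rewrite -(bigcup2E M B) -[X in Q X](_ :
    \bigcup_n (if n is n'.+1 then A n' else B) = _).
    by apply: QU => -[].
  apply/seteqP; split => [w [[|n] _ /= Aw]|].
  - by rewrite bigcup2E; right.
  - by rewrite bigcup2E; left; exists n.
  - rewrite bigcup2E => w [[n _ Aw]|Bw]; first by exists n.+1.
    by exists 0%N.
have : fine (P (M `|` B)) <= sup S.
  by apply: ub_le_sup; [exists 1|exists (M `|` B) => //; split => //; exact:
    subU].
have -> : M `|` B = M `|` (B `\` M).
  by apply/seteqP; split => w; have := EM (M w); rewrite /setU/setD/=; tauto.
rewrite measureU//; last by rewrite setDE setICA setICr setI0.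
rewrite fineD ?fin_num_measure// => PMB.
have : fine (P (B `\` M)) <= 0 by lra.
move=> PBM; apply/eqP; rewrite eq_le measure_ge0 andbT.
by rewrite -[leLHS]fineK ?fin_num_measure// lee_fin.
Qed.

(* Index 0 marks the complement of the union of the glued blocks. *)
Definition F_local Q := [/\ forall A B, F A -> F B -> B `<=` A -> Q A -> Q B,
  forall A, F A -> P A = 0%E -> Q A &
  forall N, sub_index F N -> (forall n, Q (N @^-1` [set n.+1])) ->
    Q (~` (N @^-1` [set 0%N]))].

(** Let [M] be a maximal subset of [D] with [Q], up to null sets. If the rest of [D] had positive
    measure, it would contain a set of positive measure with [Q], against maximality. So the rest is
    null, satisfies [Q], and can be glued to [M]. *)
Lemma local_to_global Q D : F_local Q -> F D ->
  (forall D', F D' -> D' `<=` D -> P D' != 0%E ->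
    exists C, [/\ F C, C `<=` D', P C != 0%E & Q C]) -> Q D.
Proof.
move=> [Qsub Qnull Qglue] FD DQ.
have QU (A : nat -> set T) : (forall n, F (A n)) -> (forall n, Q (A n)) ->
    Q (\bigcup_n A n).
  move=> FA QA; have [N FN [NA <-]] := exists_sub_index FA.
  by apply: Qglue => // n; apply: Qsub (NA n) _.
have [M [FM [QM MD] maxM]] : exists M, [/\ F M, Q M /\ M `<=` D &
    forall A, F A -> Q A /\ A `<=` D -> P (A `\` M) = 0%E].
  apply: (@exhaustion (fun A => Q A /\ A `<=` D)).
    by split => //; apply: Qnull; [exact: sub0|exact: measure0].
  move=> A FA QA; split; first by apply: QU => // n; case: (QA n).
  by apply: bigcup_sub => n _; case: (QA n).
have FDM : F (D `\` M) by exact: subD.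
have QDM : Q (D `\` M).
  apply: Qnull => //; apply: contrapT => /eqP PDM.
  have [C [FC CDM PC QC]] := DQ _ FDM (@subDsetl _ _ _) PDM.
  have CM : C `\` M = C by apply/seteqP; split => [w []|w Cw]//; split => //;
    case: (CDM w Cw).
  move/negP: PC; apply; rewrite -CM maxM//.
  by split => // w /CDM[].
have -> : D = \bigcup_n (if n is 0%N then M else D `\` M).
  apply/seteqP; split => [w Dw|w [[|n] _ //=]]; [|exact: MD|by case].
  have [Mw|nMw] := pselect (M w); first by exists 0%N.
  by exists 1%N.
by apply: QU => -[|n].
Qed.

End exhaustion.

(** * Bounds on the conditional norm *)

Section condnorm_bound.
Local Open Scope ereal_scope.
Context {d : measure_display} {T : measurableType d} {R : realType}.
Context (P : probability T R) (F : subSigmaAlgebra T).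
Local Notation L0 := {mfun_ P, T >-> R}.
Local Notation Lbar0 := {mfun_ P, T >-> \bar R}.

(* When [e] is nonnegative and F-measurable, this means [|||x|||_p <= e]; it does
   not refer to the existence of conditional expectations or infima. *)
Definition condnorm_le (p : \bar R) (x e : T -> R) : Prop :=
  match p with
  | r%:E => forall A, F A ->
      \int[P]_(w in A) abs_powR r (x w) <= \int[P]_(w in A) abs_powR r (e w)
  | _ => \forall w \ae P, (`|x w| <= `|e w|)%R
  end.

Lemma abs_powR_ge0 (r t : R) : 0 <= abs_powR r t.
Proof. by rewrite lee_fin powR_ge0. Qed.

Lemma measurable_abs_powR_comp d1 (T1 : measurableType d1) r (f : T1 -> R) D :
  measurable_fun D f -> measurable_fun D (fun w => abs_powR r (f w)).
Proof. by move=> mf; apply: measurableT_comp mf; exact: measurable_abs_powR.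
  Qed.

Lemma extL0E (x : L0) : \forall w \ae P, extL0 x w = (x w)%:E.
Proof. by have := aeEqMfun_reprK P (real_to_ext \o repr x); apply: filterS =>
  w /(_ Logic.I). Qed.

Lemma mapL0E d2 (T2 : measurableType d2) d3 (T3 : measurableType d3)
  (g : {mfun T2 >-> T3}) (x : {mfun_ P, T >-> T2}) :
  \forall w \ae P, mapL0 g x w = g (x w).
Proof. by have := aeEqMfun_reprK P (g \o repr x); apply: filterS =>
  w /(_ Logic.I). Qed.

Lemma cstLbar0E c : \forall w \ae P, cstLbar0 P c w = c.
Proof.
by have := aeEqMfun_reprK P (cst c : {mfun T >-> \bar R}); apply: filterS =>
  w /(_ Logic.I).
Qed.

Lemma ae_False : ~ \forall w \ae P, False.
Proof.
move=> [N [mN N0 NT]]; have : P setT = 0.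
  by rewrite -N0; congr (P _); apply/seteqP; split => // w _; exact: NT.
by rewrite probability_setT => /eqP; rewrite onee_eq0.
Qed.

(* Zero when [f] is not measurable. *)
Definition Lbar0_of (f : T -> \bar R) : Lbar0 :=
  match pselect (measurable_fun [set: T] f) with
  | left mf => toLbar0 P (mfun_Sub (mem_set mf))
  | right _ => zeroLbar0 P
  end.

Lemma Lbar0_ofE (f : T -> \bar R) : measurable_fun [set: T] f ->
  \forall w \ae P, Lbar0_of f w = f w.
Proof.
move=> mf; rewrite /Lbar0_of; case: pselect => // mf'.
by have := aeEqMfun_reprK P (mfun_Sub (mem_set mf')); apply: filterS =>
  w /(_ Logic.I).
Qed.

Lemma Lbar0_ae (x y : Lbar0) : (\forall w \ae P, x w = y w) -> x = y.
Proof.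
move=> xy; rewrite -[x]reprK -[y]reprK.
by apply: toLbar0P; apply: filterS xy => w + _.
Qed.

Lemma Lbar0F_ge0_rep (y : Lbar0) : Lbar0F_ge0 F y ->
  exists g : T -> \bar R, [/\ measurable_fun [set: subT F] g,
    forall w, 0 <= g w & \forall w \ae P, y w = g w].
Proof.
move=> [[g mg yg] y0]; exists (fun w => `|g w|); split => //.
  exact: measurableT_comp.
apply: filterS2 yg y0 => w /(_ Logic.I) yw yw0.
by rewrite -yw gee0_abs.
Qed.

Lemma Lbar0F_ge0_of (g : T -> \bar R) : measurable_fun [set: subT F] g ->
  (forall w, 0 <= g w) -> Lbar0F_ge0 F (Lbar0_of g).
Proof.
move=> mg g0; have gE := Lbar0_ofE (sub_measurable_fun mg).
split; first by exists g => //; apply: filterS gE.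
by apply: filterS gE => w ->.
Qed.

Lemma Lbar0F_ge0_extL0 (y : Lbar0) (e : L0) : Lbar0F_ge0 F y ->
  le_as y (extL0 e) -> exists2 xi, L0F_ge0 F xi & y = extL0 xi.
Proof.
move=> /Lbar0F_ge0_rep[g [mg g0 yg]] ye.
have mfg : measurable_fun [set: subT F] (fine \o g) by exact: measurableT_comp.
have fgE := L0_ofE P (sub_measurable_fun mfg).
exists (L0_of P (fine \o g)).
  split; first exact: F_measurable_L0_of.
  by apply: filterS fgE => w -> /=; rewrite fine_ge0.
apply: Lbar0_ae; near=> w.
have -> : y w = g w by near: w.
have -> : extL0 (L0_of P (fine \o g)) w = (L0_of P (fine \o g) w)%:E.
  by near: w; exact: extL0E.
have -> : L0_of P (fine \o g) w = fine (g w) by near: w.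
rewrite fineK// ge0_fin_numE//.
have <- : y w = g w by near: w.
apply: (@le_lt_trans _ _ (extL0 e w)); first by near: w.
have -> : extL0 e w = (e w)%:E by near: w; exact: extL0E.
by rewrite ltry.
Unshelve. all: by end_near. Qed.

Lemma L0F_gt0_rep (e : L0) : L0F_gt0 F e -> exists f : T -> R,
  [/\ measurable_fun [set: subT F] f, forall w, (0 <= f w)%R &
   \forall w \ae P, e w = f w].
Proof.
move=> [/L0F_rep[f mf ef] e0]; exists (fun w => `|f w|)%R; split => //.
  exact: measurableT_comp.
by apply: filterS2 ef e0 => w <- /ltW e0; rewrite ger0_norm.
Qed.

Lemma eq_integral_sub_ae (A : set T) (f g : T -> \bar R) : F A ->
  measurable_fun [set: T] f -> measurable_fun [set: T] g ->
  (\forall w \ae P, f w = g w) ->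
  \int[P]_(w in A) f w = \int[P]_(w in A) g w.
Proof.
move=> FA mf mg fg; apply: ae_eq_integral => //.
- exact: sub_measurable FA.
- exact: measurable_funTS.
- exact: measurable_funTS.
- by apply: filterS fg => w ->.
Qed.

End condnorm_bound.

Section condnorm_bound.
Local Open Scope ereal_scope.
Context {d : measure_display} {T : measurableType d} {R : realType}.
Context (P : probability T R) (F : subSigmaAlgebra T).
Local Notation L0 := {mfun_ P, T >-> R}.
Local Notation Lbar0 := {mfun_ P, T >-> \bar R}.

(** On the F-set where [n <= e < n.+1] the bound makes [|x| ^ r] integrable, and these sets form a
    partition as [condexp_exists] requires. *)
Lemma condE_abs_powRP (r : R) (x e : L0) : (0 <= r)%R -> L0F_gt0 F e ->
  condnorm_le P F r%:E x e -> is_condE F (mapL0 (abs_powR r) x)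
    (condE F (mapL0 (abs_powR r) x)).
Proof.
move=> r0 e0 xe.
suff [y yP] : exists y, is_condE F (mapL0 (abs_powR r) x) y.
  by rewrite /condE; apply: (@xgetPex _ (cstLbar0 P +oo) [set y | is_condE F _
    y]); exists y.
have [f [mf f0 ef]] := L0F_gt0_rep e0.
pose N w := Num.truncn (f w).
have NE n : N @^-1` [set n] = f @^-1` `[n%:R, n.+1%:R[%classic.
  apply/seteqP; split => w /=; rewrite in_itv/= /N.
    by move=> <-; exact: truncn_itv.
  by move=> /truncn_def ->.
have FN : sub_index F N.
  move=> n; rewrite NE -subTE -[X in measurable X]setTI.
  exact: mf.
have mu : measurable_fun [set: T] (fun w => abs_powR r (x w)).
  by apply: measurable_abs_powR_comp; exact: measurable_L0.
have fin n : \int[P]_(w in N @^-1` [set n]) abs_powR r (x w) < +oo.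
  apply: (le_lt_trans (xe _ (FN n))).
  have mN := sub_measurable (FN n).
  rewrite (@eq_integral_sub_ae _ _ _ P F _ _ (fun w =>
    abs_powR r (f w)) (FN n)).
  - apply: (@le_lt_trans _ _ (\int[P]_(w in N @^-1` [set n]) abs_powR r
    n.+1%:R)).
      apply: ge0_le_integral => //; try by move=> w _; exact: abs_powR_ge0.
      + apply: measurable_funTS; apply: measurable_abs_powR_comp.
        exact: sub_measurable_fun mf.
      + move=> w; rewrite NE/= in_itv/= => /andP[_ /ltW fn].
        by rewrite lee_fin ge0_ler_powR// ?nnegrE// !ger0_norm.
    by rewrite integral_cst// ltey_eq fin_numM// fin_num_measure.
  - by apply: measurable_abs_powR_comp; exact: measurable_L0.
  - by apply: measurable_abs_powR_comp; exact: sub_measurable_fun mf.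
  - by apply: filterS ef => w ->.
have [y [my y0 yE]] := condexp_exists FN mu (fun w => abs_powR_ge0 _ _) fin.
have yyE := Lbar0_ofE P (sub_measurable_fun my).
exists (Lbar0_of P y); split; first exact: Lbar0F_ge0_of.
move=> A FA; rewrite (@eq_integral_sub_ae _ _ _ P F _ _ y FA) ?yE//.
- apply: (@eq_integral_sub_ae _ _ _ P F) => //.
  by apply: filterS (mapL0E (abs_powR r) x) => w ->.
- exact: sub_measurable_fun my.
Qed.

(** For each nonnegative rational q there is a largest F-set on which [|x| <= q], by exhaustion. The
    envelope is the infimum over q of the function equal to q on this set and to [+oo] off it. For
    any other bound [y], the set where [y <= q] lies in the largest one up to a null set, so the
    envelope is below [y]. *)
Lemma ess_envelope (x : L0) : exists z : Lbar0, [/\ Lbar0F_ge0 F z,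
  \forall w \ae P, `|x w|%:E <= z w &
  forall y, Lbar0F_ge0 F y -> (\forall w \ae P, `|x w|%:E <= y w) -> le_as z y].
Proof.
(* An enumeration of the nonnegative rationals; the absolute value and the default 0 keep every term
   nonnegative. *)
pose q i : R := if @unpickle rat i is Some s then `|ratr s|%R else 0%R.
have q0 i : (0 <= q i)%R by rewrite /q; case: unpickle.
pose Q i A := \forall w \ae P, A w -> (`|x w| <= q i)%R.
have /choice[M MP] i : exists M, [/\ F M, Q i M & forall A, F A -> Q i A -> P
  (A `\` M) = 0].
  apply: exhaustion; first exact: aeW.
  move=> A FA QA; have : \forall w \ae P, forall n, A n w -> (`|x w| <= q i)%R.
    by apply: ae_foralln => n; exact: QA.
  by apply: filterS => w xA [n _]; exact: xA.
have FM i : F (M i) by case: (MP i).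
pose h i w : \bar R := if w \in M i then (q i)%:E else +oo.
pose z w := einfs (h^~ w) 0%N.
have zh w i : z w <= h i w by apply: ereal_inf_lbound; exists i.
have mz : measurable_fun [set: subT F] z.
  apply: measurable_fun_einfs => i; apply: measurable_fun_ifT => //.
  apply: (measurable_fun_bool true) => //.
  rewrite setTI (_ : _ @^-1` _ = M i) ?subTE//.
  by apply/seteqP; split => w; [move=> /set_mem|move=> /mem_set].
have z0 w : 0 <= z w.
  apply: le_ereal_inf_tmp => _ [i _ <-]; rewrite /h; case: ifP => _ //.
  by rewrite lee_fin.
have zE := Lbar0_ofE P (sub_measurable_fun mz).
exists (Lbar0_of P z); split; first exact: Lbar0F_ge0_of.
  have : \forall w \ae P, forall i, M i w -> (`|x w| <= q i)%R.
    by apply: ae_foralln => i; case: (MP i).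
  apply: filterS2 zE => w -> xM.
  apply: le_ereal_inf_tmp => _ [i _ <-]; rewrite /h; case: ifPn =>
    [/set_mem /xM|_].
    by rewrite lee_fin.
  by rewrite leey.
move=> y y0 xy.
have [g [mg g0 yg]] := Lbar0F_ge0_rep y0.
have FA i : F (g @^-1` [set t | t <= (q i)%:E]).
  rewrite -subTE -[X in measurable X]setTI.
  by apply: (@measurable_lee _ (subT F) R setT).
have gM : \forall w \ae P, forall i, g w <= (q i)%:E -> M i w.
  apply: ae_foralln => i; have [_ _ maxM] := MP i.
  have PA : P (g @^-1` [set t | t <= (q i)%:E] `\` M i) = 0.
    apply: maxM => //; apply: filterS2 xy yg => w xw yw /=.
    by rewrite -lee_fin -yw; exact: le_trans.
  have := ae_notin (sub_measurable (subD (FA i) (FM i))) PA.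
  by apply: filterS => w /not_andP[//|/contrapT].
rewrite /le_as; apply: filterS3 zE yg gM => w -> -> gM.
rewrite leNgt; apply/negP => gz.
(* As [z w] may be [+oo], a real [t] is inserted first, then a rational between [g w] and [t]. *)
have [t gt tz] : exists2 t, g w < t%:E & t%:E < z w.
  move: (g0 w) gz; case: (g w) => [a| |]//; last by move=> _;
    rewrite ltNge leey.
  case: (z w) => [b _|_ _|]//.
    rewrite lte_fin => ab; exists ((a + b) / 2)%R.
      by rewrite lte_fin midf_lt.
    by rewrite lte_fin midf_lt.
  exists (a + 1)%R; first by rewrite lte_fin ltrDl.
  by rewrite ltry.
move: (g0 w) gt tz; case: (g w) (gM) => [a| |]// gM'.
rewrite lee_fin lte_fin => a0 /rat_in_itvoo[s]; rewrite in_itv/= =>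
  /andP[as_ st] tz.
have qs : q (pickle s) = ratr s :> R.
  by rewrite /q pickleK ger0_norm// (le_trans a0)// ltW.
have /mem_set Ms : M (pickle s) w by apply: gM'; rewrite qs lee_fin ltW.
have := zh w (pickle s); rewrite /h Ms qs leNgt => /negP; apply.
by apply: lt_trans tz; rewrite lte_fin.
Qed.

End condnorm_bound.

(** * Equivalence of the bounds with inequalities on [condnorm] *)

Section condnorm_link.
Local Open Scope ereal_scope.
Context {d : measure_display} {T : measurableType d} {R : realType}.
Context (P : probability T R) (F : subSigmaAlgebra T).
Local Notation L0 := {mfun_ P, T >-> R}.
Local Notation Lbar0 := {mfun_ P, T >-> \bar R}.

(** The envelope is itself an admissible bound and lies below whichever infimum [xget] selects.
    Hence the selected infimum also dominates [|x|], that is, it is attained. *)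
Lemma condnorm_inftyP (x : L0) : is_infimum F
    [set xi : Lbar0 | Lbar0F_ge0 F xi /\ \forall w \ae P, `|x w|%:E <= xi w]
    (condnorm F +oo x) /\ \forall w \ae P, `|x w|%:E <= condnorm F +oo x w.
Proof.
have [z [z0 xz zmin]] := ess_envelope F x.
set S := [set xi | _].
have zS : is_infimum F S z.
  split => // [y [y0 xy]|y _]; first exact: zmin.
  by apply; split.
have S' : is_infimum F S (condnorm F +oo x).
  by rewrite /condnorm /infimumLbar0; apply:
    (@xgetPex _ _ [set y | is_infimum F S y]); exists z.
split => //; have [_ _ /(_ z z0)] := S'.
move=> zle; apply: filterS2 xz (zle _) => [w|y [y0 xy]]; last exact: zmin.
exact: le_trans.
Qed.

Lemma condnorm_finE (r : R) (x : L0) : \forall w \ae P,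
  condnorm F r%:E x w = condE F (mapL0 (abs_powR r) x) w `^ r^-1.
Proof. by apply: filterS (mapL0E (ext_powR r^-1) (condE F (mapL0 (abs_powR r)
  x))) => w ->. Qed.

Lemma poweRVK (r : R) (t : \bar R) :
  (0 < r)%R -> 0 <= t -> (t `^ r^-1) `^ r = t.
Proof. by move=> r0 t0; rewrite -poweRrM mulVf ?gt_eqF// poweRe1. Qed.

Lemma abs_powRVK (r t : R) :
  (0 < r)%R -> (0 <= t)%R -> abs_powR r t `^ r^-1 = t%:E.
Proof.
by move=> r0 t0; rewrite poweR_EFin ger0_norm// -powRrM mulfV ?gt_eqF// powRr1.
Qed.

(** For finite p, comparing integrals over all sets of F gives E[|x|^r | F] <= e^r almost surely by
    [cond_le_ae], and the r-th root is monotone. *)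
Lemma condnorm_le_as (p : \bar R) (x e : L0) : 1 <= p -> L0F_gt0 F e ->
  condnorm_le P F p x e ->
  Lbar0F_ge0 F (condnorm F p x) /\ le_as (condnorm F p x) (extL0 e).
Proof.
case: p => [r| |]// r1 e0 xe; last first.
  have [[n0 nS nmin] _] := condnorm_inftyP x.
  split => //; apply: nS; split.
    split; last by apply: filterS2 (extL0E e) e0.2 => w -> /ltW;
      rewrite lee_fin.
    have [f mf ef] := e0.1; exists (EFin \o f); first exact/measurable_EFinP.
    by apply: filterS2 (extL0E e) ef => w -> /(_ Logic.I) -> _.
  apply: filterS3 (extL0E e) xe e0.2 => w -> xe ew.
  by rewrite lee_fin (le_trans xe)// gtr0_norm.
have r0 : (0 < r)%R by rewrite (lt_le_trans ltr01)// -lee_fin.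
have [y0 yE] := condE_abs_powRP (ltW r0) e0 xe.
set y := condE F _ in y0 yE.
have [g [mg g0 yg]] := Lbar0F_ge0_rep y0.
have [f [mf f0 ef]] := L0F_gt0_rep e0.
have gf : \forall w \ae P, g w <= (fine (abs_powR r (f w)))%:E.
  apply: (@cond_le_ae _ _ _ P F) => //.
  - by apply: measurableT_comp => //; exact: measurable_abs_powR_comp.
  - by move=> w; rewrite fine_ge0// abs_powR_ge0.
  move=> A FA.
  have <- : \int[P]_(w in A) y w = \int[P]_(w in A) g w.
    by apply: (eq_integral_sub_ae FA) => //; exact: sub_measurable_fun mg.
  rewrite yE//.
  have -> : \int[P]_(w in A) mapL0 (abs_powR r) x w = \int[P]_(w in A) abs_powR
    r (x w).
    apply: (eq_integral_sub_ae FA) => //; last exact: mapL0E.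
    by apply: measurable_abs_powR_comp; exact: measurable_L0.
  apply: (le_trans (xe _ FA)).
  have -> : \int[P]_(w in A) abs_powR r (e w) = \int[P]_(w in A) abs_powR r (f
    w).
    apply: (eq_integral_sub_ae FA) => //.
    - by apply: measurable_abs_powR_comp; exact: measurable_L0.
    - by apply: measurable_abs_powR_comp; exact: sub_measurable_fun mf.
    - by apply: filterS ef => w ->.
  exact: lexx.
split.
  have mgr : measurable_fun [set: subT F] (fun w => g w `^ r^-1).
    exact: measurableT_comp (@measurable_poweR R r^-1%R) mg.
  have := Lbar0F_ge0_of P mgr (fun w => poweR_ge0 _ _).
  congr (Lbar0F_ge0 F _); apply: Lbar0_ae.
  apply: filterS3 (condnorm_finE r x) (Lbar0_ofE P (sub_measurable_fun mgr)) yg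
    => w -> ->.
  by move=> <-.
near=> w.
have -> : condnorm F r%:E x w = y w `^ r^-1 by near: w; exact: condnorm_finE.
have -> : extL0 e w = (e w)%:E by near: w; exact: extL0E.
have -> : y w = g w by near: w.
have -> : e w = f w by near: w.
rewrite -(abs_powRVK r0 (f0 w)); apply: gt0_ler_poweR.
- by rewrite invr_ge0 ltW.
- by rewrite in_itv/= g0 leey.
- by rewrite in_itv/= abs_powR_ge0 leey.
- by near: w.
Unshelve. all: by end_near. Qed.

Lemma le_as_condnorm (p : \bar R) (x e : L0) : 1 <= p -> L0F_gt0 F e ->
  le_as (condnorm F p x) (extL0 e) -> condnorm_le P F p x e.
Proof.
case: p => [r| |]// r1 e0 xe; last first.
  have [_ xn] := condnorm_inftyP x.
  rewrite /condnorm_le; near=> w.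
  rewrite -lee_fin; apply: (@le_trans _ _ (condnorm F +oo x w)); first by near:
    w.
  apply: (@le_trans _ _ (extL0 e w)); first by near: w.
  have -> : extL0 e w = (e w)%:E by near: w; exact: extL0E.
  by rewrite lee_fin ler_norm.
have r0 : (0 < r)%R by rewrite (lt_le_trans ltr01)// -lee_fin.
have [y0 yE] : is_condE F (mapL0 (abs_powR r) x) (condE F (mapL0 (abs_powR r)
  x)).
  (* If no conditional expectation existed, [condE] would take its default value [+oo], whose r-th
     root cannot lie below the finite [e]. *)
  apply: (@xgetPex _ (cstLbar0 P +oo) [set y | is_condE F _ y]); apply:
    contrapT => nex.
  apply: (@ae_False _ _ _ P); near=> w.
  have : condnorm F r%:E x w <= extL0 e w by near: w.
  have -> : condnorm F r%:E x w = condE F (mapL0 (abs_powR r) x) w `^ r^-1.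
    by near: w; exact: condnorm_finE.
  have -> : condE F (mapL0 (abs_powR r) x) w = +oo.
    rewrite /condE xgetPN; first by near: w; exact: cstLbar0E.
    by move=> y yP; apply: nex; exists y.
  have -> : extL0 e w = (e w)%:E by near: w; exact: extL0E.
  by rewrite poweRyr ?invr_neq0 ?gt_eqF// leNgt ltry.
set y := condE F _ in y0 yE.
move=> A FA.
have <- : \int[P]_(w in A) mapL0 (abs_powR r) x w = \int[P]_(w in A) abs_powR r
  (x w).
  apply: (eq_integral_sub_ae FA) => //; last exact: mapL0E.
  by apply: measurable_abs_powR_comp; exact: measurable_L0.
have [g [mg g0 yg]] := Lbar0F_ge0_rep y0.
rewrite -yE//.
have -> : \int[P]_(w in A) y w = \int[P]_(w in A) g w.
  by apply: (eq_integral_sub_ae FA) => //; exact: sub_measurable_fun mg.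
apply: ae_ge0_le_integral => //.
- exact: sub_measurable FA.
- by apply: measurable_funTS; exact: sub_measurable_fun mg.
- by move=> w _; exact: abs_powR_ge0.
- by apply: measurable_funTS; apply: measurable_abs_powR_comp; exact:
  measurable_L0.
near=> w => _.
rewrite -(poweRVK r0 (g0 w)).
have ew : (0 < e w)%R by near: w; exact: e0.2.
have -> : abs_powR r (e w) = (e w)%:E `^ r by rewrite poweR_EFin /abs_powR
  gtr0_norm.
apply: gt0_ler_poweR.
- exact: ltW.
- by rewrite in_itv/= poweR_ge0 leey.
- by rewrite in_itv/= lee_fin ltW// leey.
have <- : y w = g w by near: w.
have <- : condnorm F r%:E x w = y w `^ r^-1 by near: w; exact: condnorm_finE.
have <- : extL0 e w = (e w)%:E by near: w; exact: extL0E.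
by near: w.
Unshelve. all: by end_near. Qed.

Lemma condLpP (p : \bar R) (x : L0) : 1 <= p ->
  condLp F p x <-> exists2 e : L0, L0F_gt0 F e & condnorm_le P F p x e.
Proof.
move=> p1; split=> [[xi [/L0F_rep[f mf xif] xi0] nxi]|[e e0 xe]]; last first.
  have [n0 ne] := condnorm_le_as p1 e0 xe.
  by have [xi xi0 nxi] := Lbar0F_ge0_extL0 n0 ne; exists xi.
(* The norm [xi] may vanish; adding 1 turns it into a strictly positive bound. *)
have mf1 : measurable_fun [set: subT F] (fun w => f w + 1)%R.
  exact: measurable_funD.
have fE := L0_ofE P (sub_measurable_fun mf1).
have e0 : L0F_gt0 F (L0_of P (fun w => f w + 1)%R).
  split; first exact: F_measurable_L0_of.
  by apply: filterS3 fE xif xi0 => w -> <- ?; rewrite ltr_wpDl.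
exists (L0_of P (fun w => f w + 1)%R) => //.
apply: le_as_condnorm => //; rewrite nxi.
near=> w.
have -> : extL0 xi w = (xi w)%:E by near: w; exact: extL0E.
have -> : extL0 (L0_of P (fun w => f w + 1)%R) w = (L0_of P (fun w =>
  f w + 1)%R w)%:E.
  by near: w; exact: extL0E.
have -> : L0_of P (fun w => f w + 1)%R w = (f w + 1)%R by near: w.
have -> : xi w = f w by near: w.
by rewrite lee_fin lerDl.
Unshelve. all: by end_near. Qed.

End condnorm_link.

(** * Comparison, gluing and series for the bounds *)

Section condnorm_le_theory.
Local Open Scope ereal_scope.
Context {d : measure_display} {T : measurableType d} {R : realType}.
Context (P : probability T R) (F : subSigmaAlgebra T).
Implicit Types (x y e : T -> R) (p : \bar R).

Lemma condnorm_le_ae p x y : 0 <= p ->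
  measurable_fun [set: T] x -> measurable_fun [set: T] y ->
  (\forall w \ae P, (`|x w| <= `|y w|)%R) -> condnorm_le P F p x y.
Proof.
case: p => [r| |]// r0 mx my xy A FA; apply: ae_ge0_le_integral => //.
- exact: sub_measurable FA.
- by move=> w _; exact: abs_powR_ge0.
- by apply: measurable_funTS; exact: measurable_abs_powR_comp.
- by move=> w _; exact: abs_powR_ge0.
- by apply: measurable_funTS; exact: measurable_abs_powR_comp.
- by apply: filterS xy => w xy _;
  rewrite lee_fin ge0_ler_powR ?nnegrE// -lee_fin.
Qed.

Lemma condnorm_le_trans p y x e :
  condnorm_le P F p x y -> condnorm_le P F p y e -> condnorm_le P F p x e.
Proof.
case: p => [r| |] xy ye; last 2 first.
- by apply: filterS2 xy ye => w; exact: le_trans.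
- by apply: filterS2 xy ye => w; exact: le_trans.
by move=> A FA; exact: le_trans (xy A FA) (ye A FA).
Qed.

Lemma abs_powRM (r c t : R) :
  abs_powR r (c * t)%R = (`|c| `^ r)%:E * abs_powR r t.
Proof. by rewrite /abs_powR normrM powRM// EFinM. Qed.

Lemma condnorm_le_scale p (c : R) x e :
  measurable_fun [set: T] x -> measurable_fun [set: T] e ->
  condnorm_le P F p x e ->
  condnorm_le P F p (fun w => c * x w)%R (fun w => c * e w)%R.
Proof.
move=> mx me; case: p => [r| |] xe; last 2 first.
- by apply: filterS xe => w xe; rewrite !normrM ler_wpM2l.
- by apply: filterS xe => w xe; rewrite !normrM ler_wpM2l.
move=> A FA; have mA := sub_measurable FA.
under eq_integral do rewrite abs_powRM.
under [leRHS]eq_integral do rewrite abs_powRM.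
have cE (f : T -> R) : measurable_fun [set: T] f ->
    \int[P]_(w in A) ((`|c| `^ r)%:E * abs_powR r (f w)) =
    (`|c| `^ r)%:E * \int[P]_(w in A) abs_powR r (f w).
  move=> mf; have mf' : measurable_fun A (fun w => abs_powR r (f w)).
    by apply: measurable_funTS; exact: measurable_abs_powR_comp.
  by rewrite ge0_integralZl_EFin ?powR_ge0// => w _; exact: abs_powR_ge0.
rewrite (cE _ mx) (cE _ me); apply: lee_wpmul2l;
  first by rewrite lee_fin powR_ge0.
exact: xe.
Qed.

Lemma condnorm_le_glue p (N : T -> nat) (u e : nat -> T -> R) :
  sub_index F N -> (forall n, measurable_fun [set: T] (u n)) ->
  (forall n, measurable_fun [set: T] (e n)) ->
  (forall n, condnorm_le P F p (u n) (e n)) ->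
  condnorm_le P F p (fun w => u (N w) w) (fun w => e (N w) w).
Proof.
move=> FN mu me; case: p => [r| |] ue; last 2 first.
- have : \forall w \ae P, forall n, (`|u n w| <= `|e n w|)%R by exact:
  ae_foralln.
  by apply: filterS.
- have : \forall w \ae P, forall n, (`|u n w| <= `|e n w|)%R by exact:
  ae_foralln.
  by apply: filterS.
move=> A FA.
have mg (v : nat -> T -> R) : (forall n, measurable_fun [set: T] (v n)) ->
    measurable_fun [set: T] (fun w => abs_powR r (v (N w) w)).
  move=> mv; apply: measurable_abs_powR_comp; apply: measurable_glue => // n.
  exact: sub_measurable (FN n).
rewrite (integral_partition P FN (mg u mu) (fun w => abs_powR_ge0 _ _) FA).
rewrite (integral_partition P FN (mg e me) (fun w => abs_powR_ge0 _ _) FA).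
apply: lee_nneseries => [n _ _|n _].
  by apply: integral_ge0 => w _; exact: abs_powR_ge0.
rewrite (eq_integral (fun w => abs_powR r (u n w))); last first.
  by move=> w /[!inE] -[_ /= ->].
rewrite [leRHS](eq_integral (fun w => abs_powR r (e n w))); last first.
  by move=> w /[!inE] -[_ /= ->].
by apply: ue; exact: subI.
Qed.

(* The weights [2 ^ j.+1] spare us Minkowski's inequality: if [s] is the right
   hand side, then [`|a j| <= s `^ r^-1 / 2 ^ j.+1], and these bounds sum up to
   [s `^ r^-1]. *)
Lemma abs_powR_series (r t : R) (a : nat -> R) : (0 < r)%R ->
  (`|t|)%:E <= \sum_(j <oo) (`|a j|)%:E ->
  abs_powR r t <= \sum_(j <oo) abs_powR r ((2 ^ j.+1)%:R * a j)%R.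
Proof.
move=> r0 ta.
have S0 : 0 <= \sum_(j <oo) abs_powR r ((2 ^ j.+1)%:R * a j)%R.
  by apply: nneseries_ge0 => j _ _; exact: abs_powR_ge0.
have Sj j : abs_powR r ((2 ^ j.+1)%:R * a j)%R <=
    \sum_(j <oo) abs_powR r ((2 ^ j.+1)%:R * a j)%R.
  apply: le_trans (nneseries_lim_ge j.+1 _); last first.
    by move=> i _ _; exact: abs_powR_ge0.
  rewrite big_nat_recr//= leeDr// sume_ge0// => i _; exact: abs_powR_ge0.
set S := \sum_(j <oo) _ in S0 Sj *.
case: S S0 Sj => [s| |]// s0 Sj; last by rewrite leey.
have aj j : (`|a j|)%:E <= (s `^ r^-1 / (2 ^ j.+1)%:R)%:E.
  rewrite lee_fin ler_pdivlMr ?ltr0n ?expn_gt0// mulrC.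
  have := Sj j; rewrite lee_fin => /(ge0_ler_powR (r := r^-1)).
  rewrite invr_ge0 (ltW r0) !nnegrE powR_ge0 -lee_fin s0 => /(_ isT isT isT).
  by rewrite -powRrM mulfV ?gt_eqF// powRr1// normrM normr_nat.
have : (`|t|)%:E <= (s `^ r^-1)%:E.
  apply: (le_trans ta); apply: le_trans (epsilon_trick0 xpredT (powR_ge0 _ _)).
  exact: lee_nneseries.
rewrite lee_fin => /(ge0_ler_powR (r := r)).
rewrite !nnegrE powR_ge0 normr_ge0 (ltW r0) => /(_ isT isT isT).
by rewrite -powRrM mulVf ?gt_eqF// powRr1 -?lee_fin.
Qed.

(** A triangle inequality for series. For finite p the weight 4 ^ j.+1 is spent twice: one factor 2
    ^ j.+1 pays for [abs_powR_series], and the remaining 1 / 2 ^ j.+1, raised to the power r >= 1,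
    is at most itself and sums up to 1. *)
Lemma condnorm_le_series p x e (y : nat -> T -> R) : 1 <= p ->
  measurable_fun [set: T] x -> measurable_fun [set: T] e ->
  (forall j, measurable_fun [set: T] (y j)) ->
  (forall j, condnorm_le P F p (y j) (fun w => (4 ^ j.+1)%:R^-1 * e w)%R) ->
  (\forall w \ae P, (`|x w|)%:E <= \sum_(j <oo) (`|y j w|)%:E) ->
  condnorm_le P F p x e.
Proof.
move=> + mx me my; case: p => [r| |]// r1 ye xy; last first.
  have {}ye : \forall w \ae P, forall j,
      (`|y j w| <= `|(4 ^ j.+1)%:R^-1 * e w|)%R by exact: ae_foralln.
  apply: filterS2 xy ye => w xy ye; rewrite -lee_fin; apply: (le_trans xy).
  apply: le_trans (epsilon_trick0 xpredT (normr_ge0 _)).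
  apply: lee_nneseries => // j _; rewrite lee_fin (le_trans (ye j))//.
  rewrite normrM mulrC ler_wpM2l// ger0_norm ?invr_ge0// lef_pV2 ?posrE ?ltr0n
    ?expn_gt0//.
  by rewrite ler_nat leq_exp2r.
have r0 : (0 < r)%R by rewrite (lt_le_trans ltr01)// -lee_fin.
move=> A FA; have mA := sub_measurable FA.
have m2 j : measurable_fun [set: T] (fun w => (2 ^ j.+1)%:R * y j w)%R.
  exact: measurable_funM.
apply: (@le_trans _ _ (\int[P]_(w in A)
    \sum_(j <oo) abs_powR r ((2 ^ j.+1)%:R * y j w)%R)).
  apply: ae_ge0_le_integral => //.
  - by move=> w _; exact: abs_powR_ge0.
  - by apply: measurable_funTS; exact: measurable_abs_powR_comp.
  - by move=> w _; apply: nneseries_ge0 => j _ _; exact: abs_powR_ge0.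
  - apply: measurable_funTS; apply: ge0_emeasurable_sum => [j w _ _|j _].
      exact: abs_powR_ge0.
    exact: measurable_abs_powR_comp.
  - by apply: filterS xy => w xy _; exact: abs_powR_series.
rewrite integral_nneseries//; last 2 first.
- by move=> j; apply: measurable_funTS; exact: measurable_abs_powR_comp.
- by move=> j w _; exact: abs_powR_ge0.
set I := \int[P]_(w in A) abs_powR r (e w).
have I0 : 0 <= I by apply: integral_ge0 => w _; exact: abs_powR_ge0.
have IE : forall j, \int[P]_(w in A) abs_powR r ((2 ^ j.+1)%:R * y j w)%R <=
    ((2 ^ j.+1)%:R^-1)%:E * I.
  move=> j.
  have m4 : measurable_fun [set: T] (fun w => (4 ^ j.+1)%:R^-1 * e w)%R.
    exact: measurable_funM.
  have h : condnorm_le P F r%:E (fun w => (2 ^ j.+1)%:R * y j w)%R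
      (fun w => (2 ^ j.+1)%:R * ((4 ^ j.+1)%:R^-1 * e w))%R.
    exact: condnorm_le_scale.
  apply: (le_trans (h A FA)).
  have -> : ((2 ^ j.+1)%:R^-1)%:E * I =
      \int[P]_(w in A) (((2 ^ j.+1)%:R^-1)%:E * abs_powR r (e w)).
    have me' : measurable_fun A (fun w => abs_powR r (e w)).
      by apply: measurable_funTS; exact: measurable_abs_powR_comp.
    by rewrite ge0_integralZl_EFin// => w _; exact: abs_powR_ge0.
  - apply: ge0_le_integral => //.
    + by move=> w _; exact: abs_powR_ge0.
    + apply: measurable_funTS; apply: measurable_abs_powR_comp.
      exact: measurable_funM.
    + apply: measurable_funTS; apply: emeasurable_funM => //.
      exact: measurable_abs_powR_comp.
    move=> w _.
    have -> : ((2 ^ j.+1)%:R * ((4 ^ j.+1)%:R^-1 * e w) = (2 ^ j.+1)%:R^-1 * e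
      w)%R.
      rewrite mulrA; congr (_ * _)%R; rewrite (_ : 4 = 2 * 2)%N// expnMn natrM.
      by field; rewrite pnatr_eq0 expn_eq0.
    rewrite abs_powRM lee_wpmul2r ?abs_powR_ge0// lee_fin ger0_norm ?invr_ge0//.
    apply: ge1r_powR; last by rewrite -lee_fin.
    by rewrite invr_gt0 ltr0n expn_gt0/= invf_le1 ?ltr0n ?expn_gt0// ler1n
      expn_gt0.
case: I I0 IE => [i| |]// i0 IE; last by rewrite leey.
apply: le_trans (epsilon_trick0 xpredT _); last by rewrite -lee_fin; exact: i0.
apply: lee_nneseries => j; first by move=> _ _; apply: integral_ge0 => w _;
  exact: abs_powR_ge0.
by move=> _; apply: (le_trans (IE j)); rewrite -EFinM mulrC.
Qed.

End condnorm_le_theory.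

(** * Completeness *)

Section real_sequences.
Context {R : realType}.

Lemma summable_increments_cvg (a : nat -> R) :
  (\sum_(j <oo) (`|a j.+1 - a j|)%:E < +oo)%E -> cvgn a.
Proof.
move=> S.
have cS : cvgn (series (telescope a)).
  apply: normed_cvg; apply: nondecreasing_is_cvgn.
    apply/nondecreasing_seqP => n;
      rewrite /normed_series_of /series/= [leRHS]big_nat_recr//=.
    by rewrite lerDl.
  exists (fine (\sum_(j <oo) (`|a j.+1 - a j|)%:E)%E) => _ [n _ <-].
  have := @nneseries_lim_ge R (fun j =>
    (`|a j.+1 - a j|)%:E) xpredT 0 n (fun _ _ _ => normr_ge0 _).
  rewrite sumEFin -[X in (_ <= X)%E -> _]fineK ?lee_fin//.
  by rewrite ge0_fin_numE//; apply: nneseries_ge0 => j _ _; rewrite lee_fin.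
rewrite (_ : a = (fun n => a 0%N + series (telescope a) n)); last first.
  by apply/funext => n; rewrite -eq_sum_telescope.
by apply: is_cvgD => //; exact: is_cvg_cst.
Qed.

Lemma dist_lim_le (a : nat -> R) n : cvgn a ->
  ((`|limn a - a n|)%:E <= \sum_(j <oo) (`|a (n + j).+1 - a (n + j)%N|)%:E)%E.
Proof.
move=> ca.
set S := (X in (_ <= X)%E).
have Sm m : (`|a (n + m)%N - a n|%:E <= S)%E.
  apply: le_trans (nneseries_lim_ge m _); last by move=> j _ _; rewrite lee_fin.
  rewrite sumEFin lee_fin.
  rewrite -[X in _ - a X](addn0 n) -(@telescope_sumr _ 0 m (fun j =>
    a (n + j)%N))//.
  by under [leRHS]eq_bigr do rewrite -addnS; exact: ler_norm_sum.
case: S Sm => [s| |] Sm; last 2 first.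
- by rewrite leey.
- by have := Sm 0%N; rewrite leNgt ltNyr.
rewrite lee_fin.
have cn : (fun m => `|a (m + n)%N - a n|) @ \oo --> `|limn a - a n|.
  apply: cvg_norm; apply: cvgB; last exact: cvg_cst.
  by rewrite (cvg_shiftn n).
rewrite -(cvg_lim _ cn)//; apply: limr_le; first by apply/cvg_ex; eexists;
  exact: cn.
by apply: nearW => m; rewrite addnC -lee_fin.
Qed.

End real_sequences.

Section completeness.
Local Open Scope ereal_scope.
Context {d : measure_display} {T : measurableType d} {R : realType}.
Context (P : probability T R) (F : subSigmaAlgebra T).
Local Notation L0 := {mfun_ P, T >-> R}.

Lemma condnorm_le_mul_eq0 (p : \bar R) (x : T -> R) (e : L0) : 1 <= p ->
  measurable_fun [set: T] x -> L0F F e ->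
  (forall n : nat, condnorm_le P F p (fun w => n%:R * x w)%R e) ->
  \forall w \ae P, x w = 0%R.
Proof.
move=> + mx /L0F_rep[f mf ef]; case: p => [r| |]// r1 xe; last first.
  have : \forall w \ae P, forall n, (`|n%:R * x w| <= `|e w|)%R.
    exact: ae_foralln.
  apply: filterS => w xew; apply/eqP; rewrite -normr_eq0 eq_le normr_ge0 andbT.
  rewrite leNgt; apply/negP => x0.
  have := xew (Num.bound (`|e w| / `|x w|)).
  rewrite normrM normr_nat -ler_pdivlMr// leNgt => /negP; apply.
  by apply: archi_boundP; rewrite divr_ge0.
(* The powers of [e] need not be integrable; on [A k] the bound is at most k, so that its r-th power
   has integral at most [k ^ r]. *)
pose A k := [set w | `|f w| <= k%:R]%R.
have FA k : F (A k).
  rewrite -subTE -[X in measurable X]setTI.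
  by apply: measurable_fun_le => //; exact: measurableT_comp.
have r0 : (0 < r)%R by rewrite (lt_le_trans ltr01)// -lee_fin.
have mAx k : measurable_fun (A k) (fun w => abs_powR r (x w)).
  by apply: measurable_funTS; exact: measurable_abs_powR_comp.
have I0 k : \int[P]_(w in A k) abs_powR r (x w) = 0.
  set J := \int[P]_(w in A k) _.
  have mA := sub_measurable (FA k).
  have J0 : 0 <= J by apply: integral_ge0 => w _; exact: abs_powR_ge0.
  (* A linear factor can be extracted because n.+1 <= n.+1 ^ r for r >= 1; being arbitrarily large,
     it forces [J = 0]. *)
  have Jk n : n.+1%:R%:E * J <= (k%:R `^ r)%:E.
    apply: (@le_trans _ _ (\int[P]_(w in A k) abs_powR r (n.+1%:R * x w)%R)).
      have -> : n.+1%:R%:E * J = \int[P]_(w in A k) (n.+1%:R%:E * abs_powR r (x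
        w)).
        by rewrite ge0_integralZl_EFin// => w _; exact: abs_powR_ge0.
      apply: ge0_le_integral => //.
      - by move=> w _; rewrite mule_ge0 ?abs_powR_ge0.
      - by apply: emeasurable_funM => //; exact: measurable_cst.
      - apply: measurable_funTS; apply: measurable_abs_powR_comp.
        exact: measurable_funM.
      - move=> w _; rewrite abs_powRM lee_wpmul2r ?abs_powR_ge0// lee_fin
        normr_nat.
        by apply: le1r_powR; rewrite ?ler1n// -lee_fin.
    apply: (le_trans (xe n.+1 _ (FA k))).
    have -> : \int[P]_(w in A k) abs_powR r (e w) = \int[P]_(w in A k) abs_powR
      r (f w).
      apply: (eq_integral_sub_ae (FA k)) => //.
      - by apply: measurable_abs_powR_comp; exact: measurable_L0.
      - by apply: measurable_abs_powR_comp; exact: sub_measurable_fun mf.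
      - by apply: filterS ef => w ->.
    apply: (@le_trans _ _ (\int[P]_(w in A k) (k%:R `^ r)%:E)).
      apply: ge0_le_integral => //.
      - by move=> w _; exact: abs_powR_ge0.
      - apply: measurable_funTS; apply: measurable_abs_powR_comp.
        exact: sub_measurable_fun mf.
      - by move=> w fk; rewrite lee_fin ge0_ler_powR ?nnegrE// ltW.
    rewrite integral_cst//; apply: (@le_trans _ _ ((k%:R `^ r)%:E * 1)).
      by rewrite lee_wpmul2l ?lee_fin ?powR_ge0// probability_le1.
    by rewrite mule1.
  apply/eqP; rewrite eq_le J0 andbT.
  case: J J0 Jk => [j| |]//; last first.
    by move=> _ /(_ 0%N); rewrite mul1e leNgt ltry.
  rewrite !lee_fin => j0 Jk; rewrite leNgt; apply/negP => j_gt0.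
  have /= := Jk (Num.bound (k%:R `^ r / j)%R).
  rewrite -EFinM lee_fin -ler_pdivlMr// leNgt => /negP; apply.
  apply: (@lt_trans _ _ (Num.bound (k%:R `^ r / j)%R)%:R)%R.
    by apply: archi_boundP; rewrite divr_ge0.
  by rewrite ltr_nat.
have : \forall w \ae P, forall k, A k w -> abs_powR r (x w) = 0.
  apply: ae_foralln => k.
  apply/(ae_eq_integral_abs _ (sub_measurable (FA k)) (mAx k)).
  rewrite -[RHS](I0 k); apply: eq_integral => w _.
  by rewrite gee0_abs// abs_powR_ge0.
apply: filterS => w /(_ (Num.bound `|f w|)) xw.
have /xw [] : A (Num.bound `|f w|) w by apply/ltW/archi_boundP.
by move=> /powR_eq0_eq0/eqP; rewrite normr_eq0 => /eqP.
Qed.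

(** Every multiple of the indicator of the set [Z] of divergence is dominated by the series, hence
    is bounded by [e]. By [condnorm_le_mul_eq0] this indicator vanishes almost surely. *)
Lemma condnorm_series_lty (p : \bar R) (y : nat -> T -> R) (e : L0) : 1 <= p ->
  (forall j, measurable_fun [set: T] (y j)) -> L0F F e ->
  (forall j, condnorm_le P F p (y j) (fun w => (4 ^ j.+1)%:R^-1 * e w)%R) ->
  \forall w \ae P, \sum_(j <oo) (`|y j w|)%:E < +oo.
Proof.
move=> p1 my Fe ye.
pose S w := \sum_(j <oo) (`|y j w|)%:E.
have mS : measurable_fun [set: T] S.
  apply: ge0_emeasurable_sum => [j w _ _|j _]; first by rewrite lee_fin.
  by apply/measurable_EFinP; exact: measurableT_comp.
pose Z := S @^-1` [set +oo].
have mZ : measurable Z by rewrite -[X in measurable X]setTI; exact: mS.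
have m1 : measurable_fun [set: T] (\1_Z : T -> R) by exact: measurable_indic.
have := @condnorm_le_mul_eq0 p _ e p1 m1 Fe.
have h n : condnorm_le P F p (fun w => n%:R * \1_Z w)%R e.
  apply: (condnorm_le_series p1 _ (measurable_L0 e) my ye).
    exact: measurable_funM.
  apply: aeW => w; rewrite indicE; case: (boolP (w \in Z)) => [/set_mem|_];
    last first.
    have S0 : 0 <= S w by apply: nneseries_ge0 => j _ _; rewrite lee_fin.
    by rewrite mulr0 normr0; exact: S0.
  by rewrite /Z/= -/(S w) => ->; rewrite leey.
move=> /(_ h); apply: filterS => w; rewrite -/(S w) indicE.
case: (boolP (w \in Z)) => [_ /eqP|/negP nZ _]; first by rewrite oner_eq0.
by rewrite ltey; apply/eqP => Sw; apply: nZ; rewrite inE.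
Qed.

(** The limit is taken pointwise. As the radii decrease, the increments from stage n on carry the
    weights of [condnorm_le_series] relative to [r n], and their absolute values sum up to a bound
    for the distance from [x n] to the limit. *)
Lemma condnorm_complete (p : \bar R) (x r : nat -> L0) : 1 <= p ->
  (forall n, L0F_gt0 F (r n)) ->
  (forall n, \forall w \ae P, (r n.+1 w <= r n w)%R) ->
  (forall n, condnorm_le P F p (fun w => x n.+1 w - x n w)%R
    (fun w => (4 ^ n.+1)%:R^-1 * r n w)%R) ->
  exists z : L0, forall n, condnorm_le P F p (fun w => z w - x n w)%R (r n).
Proof.
move=> p1 r0 rS xr.
have mx n : measurable_fun [set: T] (x n) := measurable_L0 (x n).
have mr n : measurable_fun [set: T] (r n) := measurable_L0 (r n).
have mxB n m : measurable_fun [set: T] (fun w => x n w - x m w)%R.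
  exact: measurable_funB.
have rle n j : \forall w \ae P, (0 <= r (n + j)%N w <= r n w)%R.
  elim: j => [|j IH]; first by rewrite addn0; apply: filterS (r0 n).2 =>
    w /ltW ->/=.
  apply: filterS3 (r0 (n + j.+1)%N).2 (rS (n + j)%N) IH => w.
  rewrite addnS => /ltW-> h /andP[_ h']/=; exact: le_trans h h'.
have tail n j : condnorm_le P F p (fun w => x (n + j).+1 w - x (n + j)%N w)%R
    (fun w => (4 ^ j.+1)%:R^-1 * r n w)%R.
  apply: (condnorm_le_trans (xr (n + j)%N)); apply: condnorm_le_ae.
  - exact: le_trans p1.
  - exact: measurable_funM.
  - exact: measurable_funM.
  apply: filterS (rle n j) => w /andP[rnj rn].
  rewrite !normrM ler_pM// ?ger0_norm ?invr_ge0// ?(le_trans rnj)//.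
  by rewrite lef_pV2 ?posrE ?ltr0n ?expn_gt0// ler_nat leq_exp2l// ltnS
    leq_addl.
have S0 := condnorm_series_lty p1 (fun j =>
  mxB (0 + j).+1 (0 + j)%N) (r0 0%N).1 (tail 0%N).
(* The upper limit is measurable on the whole space and agrees with the limit wherever the
   increments are summable. *)
pose z w := fine (limn_esup (fun n => (x n w)%:E)).
have mz : measurable_fun [set: T] z.
  apply: measurableT_comp => //; apply: measurable_fun_limn_esup => n.
  exact/measurable_EFinP.
have zE := L0_ofE P mz.
exists (L0_of P z) => n.
apply: (condnorm_le_series p1 _ (mr n) (fun j => mxB _ _) (tail n)).
  by apply: measurable_funB => //; exact: measurable_L0.
apply: filterS2 zE S0 => w -> S0.
have cx : cvgn (fun n => x n w) by exact: summable_increments_cvg.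
have -> : z w = limn (fun n => x n w).
  have cxE : (fun n => (x n w)%:E) @ \oo --> (limn (fun n =>
    x n w))%:E by apply: cvg_EFin => //; exact: nearW.
  rewrite /z is_cvg_limn_esupE; last by apply/cvg_ex; eexists; exact: cxE.
  by rewrite (cvg_lim _ cxE).
exact: (dist_lim_le n cx).
Qed.

End completeness.

(** * Balls *)

Section L0_bounds.
Context {d : measure_display} {T : measurableType d} {R : realType}.
Context (P : probability T R) (F : subSigmaAlgebra T).
Context (p : \bar R) (p1 : (1 <= p)%E).
Local Notation L0 := {mfun_ P, T >-> R}.
Implicit Types (x y z e r : L0).

Lemma L0F_gt0_of (f : T -> R) : measurable_fun [set: subT F] f ->
  (forall w, 0 < f w) -> L0F_gt0 F (L0_of P f).
Proof.
move=> mf f0; split; first exact: F_measurable_L0_of.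
by apply: filterS (L0_ofE P (sub_measurable_fun mf)) => w ->.
Qed.

Lemma L0F_gt0_pos_rep e : L0F_gt0 F e -> exists f : T -> R,
  [/\ measurable_fun [set: subT F] f, forall w, 0 < f w &
   \forall w \ae P, e w = f w].
Proof.
move=> [/L0F_rep[f mf ef] e0]; exists (fun w => if 0 < f w then f w else 1);
  split.
- by apply: measurable_fun_ifT => //; exact: measurable_fun_ltr.
- by move=> w; case: ifP.
- by apply: filterS2 ef e0 => w <- ->.
Qed.

Lemma L0F_gt0_glue (N : T -> nat) (e : nat -> L0) : sub_index F N ->
  (forall n, L0F_gt0 F (e n)) -> L0F_gt0 F (glueL0 N e).
Proof.
move=> FN e0; have /choice[f fP] n := L0F_gt0_pos_rep (e0 n).
have mg : measurable_fun [set: subT F] (fun w => f (N w) w).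
  apply: (@measurable_glue _ (subT F) _ _ N f) => n; last by case: (fP n).
  by rewrite subTE; exact: FN.
have -> : glueL0 N e = L0_of P (fun w => f (N w) w).
  apply: L0_ae.
  have ef : \forall w \ae P, forall n, e n w = f n w.
    by apply: ae_foralln => n; case: (fP n).
  by apply: filterS3 (glueL0E e FN) (L0_ofE P (sub_measurable_fun mg)) ef =>
    w -> -> ->.
by apply: L0F_gt0_of => // w; case: (fP (N w)).
Qed.

Lemma L0F_gt0_scale (c : R) e : 0 < c -> L0F_gt0 F e -> L0F_gt0 F (scaleL0 c e).
Proof.
move=> c0 /L0F_gt0_pos_rep[f [mf f0 ef]].
have mcf : measurable_fun [set: subT F] (fun w => c * f w) by exact:
  measurable_funM.
have -> : scaleL0 c e = L0_of P (fun w => c * f w).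
  apply: L0_ae.
  by apply: filterS3 (scaleL0E c e) (L0_ofE P (sub_measurable_fun mcf)) ef =>
    w -> -> ->.
by apply: L0F_gt0_of => // w; rewrite mulr_gt0.
Qed.

Definition ballL0 (x e : L0) := condnorm_le P F p x e.

Lemma ballL0_ae x y : (\forall w \ae P, `|x w| <= `|y w|) -> ballL0 x y.
Proof.
move=> xy; apply: condnorm_le_ae => //; [|exact: measurable_L0..].
exact: le_trans p1.
Qed.

Lemma ballL0_trans y x e : ballL0 x y -> ballL0 y e -> ballL0 x e.
Proof. exact: condnorm_le_trans. Qed.

Lemma ballL0_glue (N : T -> nat) (u e : nat -> L0) x r : sub_index F N ->
  (forall n, ballL0 (u n) (e n)) -> (\forall w \ae P, x w = u (N w) w) ->
  (\forall w \ae P, r w = e (N w) w) -> ballL0 x r.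
Proof.
move=> FN ue xu re.
have mglue (v : nat -> L0) : measurable_fun [set: T] (fun w => v (N w) w).
  apply: (@measurable_glue _ _ _ _ N (fun n => v n : T -> R)) => n.
    exact: sub_measurable (FN n).
  exact: measurable_L0.
have p0 : (0 <= p)%E by exact: le_trans p1.
have h := condnorm_le_glue FN (fun n => measurable_L0 (u n))
  (fun n => measurable_L0 (e n)) ue.
apply: (condnorm_le_trans (y := fun w => u (N w) w)).
  apply: (condnorm_le_ae _ p0 (measurable_L0 x) (mglue u)).
  by apply: filterS xu => w ->.
apply: (condnorm_le_trans h).
apply: (condnorm_le_ae _ p0 (mglue e) (measurable_L0 r)).
by apply: filterS re => w ->.
Qed.

(** Glue [y], with radius [e], on [A] to 0, with radius [r], off [A]: the radius matters only where
    the element is not cut off. *)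
Lemma ballL0_restr (A : set T) x y e r : F A -> ballL0 y e ->
  (\forall w \ae P, x w = \1_A w * y w) ->
  (\forall w \ae P, A w -> e w = r w) -> ballL0 x r.
Proof.
move=> FA ye xy er.
apply: (@ballL0_glue (fun w => w \in A) (fun n => if n is 0%N then 0 else y)
  (fun n => if n is 0%N then r else e) x r (sub_index_bool FA)).
- case=> [|n]//; apply: ballL0_ae; apply: filterS (L0_0E P) => w -> .
  by rewrite normr0.
- apply: filterS2 xy (L0_0E P) => w -> z0; rewrite indicE.
  by case: (w \in A); rewrite /= ?mul1r// mul0r z0.
- apply: filterS er => w Aer; case: (boolP (w \in A)) => [/set_mem Aw|]//=.
  by rewrite Aer.
Qed.

Lemma ballL0_scale (c : R) x e y r : ballL0 x e ->
  (\forall w \ae P, y w = c * x w) -> (\forall w \ae P, r w = c * e w) ->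
  ballL0 y r.
Proof.
move=> xe yx re.
have p0 : (0 <= p)%E by exact: le_trans p1.
have mc (v : L0) : measurable_fun [set: T] (fun w => c * v w).
  by apply: measurable_funM => //; exact: measurable_L0.
have h := condnorm_le_scale c (measurable_L0 x) (measurable_L0 e) xe.
apply: (condnorm_le_trans (y := fun w => c * x w)).
  apply: (condnorm_le_ae _ p0 (measurable_L0 y) (mc x)).
  by apply: filterS yx => w ->.
apply: (condnorm_le_trans h).
apply: (condnorm_le_ae _ p0 (mc e) (measurable_L0 r)).
by apply: filterS re => w ->.
Qed.

(* 16 = 4 ^ 2 is the weight of the second term in [condnorm_le_series]. *)
Lemma ballL0_add x y z e r : ballL0 x e -> ballL0 y e ->
  (\forall w \ae P, z w = x w + y w) ->
  (\forall w \ae P, `|e w| <= `|16^-1 * r w|) -> ballL0 z r.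
Proof.
move=> xe ye zxy er.
have p0 : (0 <= p)%E by exact: le_trans p1.
pose u j : L0 := match j with 0%N => x | 1%N => y | _ => 0 end.
have mr (c : R) : measurable_fun [set: T] (fun w => c * r w).
  by apply: measurable_funM => //; exact: measurable_L0.
apply: (condnorm_le_series p1 (measurable_L0 z) (measurable_L0 r)
  (fun j => measurable_L0 (u j))).
- have e16 j : (j < 2)%N -> condnorm_le P F p e (fun w =>
  (4 ^ j.+1)%:R^-1 * r w).
    move=> j2; apply: (condnorm_le_ae _ p0 (measurable_L0 e) (mr _)).
    apply: filterS er => w /le_trans; apply; rewrite !normrM ler_wpM2r//.
    rewrite !ger0_norm ?invr_ge0// lef_pV2 ?posrE ?ltr0n ?expn_gt0//.
    by rewrite ler_nat; case: j j2 => [|[|]].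
  case=> [|[|j]]; [exact: condnorm_le_trans (e16 _ _)|exact:
    condnorm_le_trans (e16 _ _)|].
  apply: (condnorm_le_ae _ p0 (measurable_L0 _) (mr _)).
  by apply: filterS (L0_0E P) => w /= ->; rewrite normr0.
- apply: filterS zxy => w ->.
  apply: (@le_trans _ _ (\sum_(0 <= j < 2) (`|u j w|)%:E)%E).
    by rewrite big_nat_recr//= big_nat1 -EFinD lee_fin ler_normD.
  by apply: nneseries_lim_ge => j _ _; rewrite lee_fin.
Qed.

Lemma condLp_ballL0 x y z r : condLp F p y -> L0F_gt0 F r -> ballL0 z r ->
  (\forall w \ae P, x w = y w + z w) -> condLp F p x.
Proof.
move=> /(condLpP _ _ p1)[e e0 ye] r0 zr xyz; apply/(condLpP _ _ p1).
have [f [mf f0 ef]] := L0F_gt0_pos_rep e0.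
have [g [mg g0 rg]] := L0F_gt0_pos_rep r0.
have ms : measurable_fun [set: subT F] (fun w => f w + g w) by exact:
  measurable_funD.
have m16 : measurable_fun [set: subT F] (fun w => 16 * (f w + g w)).
  exact: measurable_funM.
(* [f + g] is a common bound for both summands, and [ballL0_add] costs the factor 16. *)
exists (L0_of P (fun w => 16 * (f w + g w))).
  by apply: L0F_gt0_of => // w; rewrite mulr_gt0// addr_gt0.
have sE := L0_ofE P (sub_measurable_fun ms).
apply: (@ballL0_add y z x (L0_of P (fun w => f w + g w))) => //.
- apply: ballL0_trans ye _; apply: ballL0_ae.
  apply: filterS2 sE ef => w -> ->.
  by rewrite !gtr0_norm ?addr_gt0// lerDl ltW.
- apply: ballL0_trans zr _; apply: ballL0_ae.
  apply: filterS2 sE rg => w -> ->.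
  by rewrite !gtr0_norm ?addr_gt0// lerDr ltW.
- apply: filterS2 sE (L0_ofE P (sub_measurable_fun m16)) => w -> ->.
  by rewrite mulKf.
Qed.

Lemma condLp_solid x y : condLp F p y ->
  (\forall w \ae P, `|x w| <= `|y w|) -> condLp F p x.
Proof.
move=> /(condLpP _ _ p1)[e e0 ye] xy; apply/(condLpP _ _ p1); exists e => //.
by apply: ballL0_trans ye; exact: ballL0_ae.
Qed.

End L0_bounds.

(** * Barrels *)

Section barrel.
Context {d : measure_display} {T : measurableType d} {R : realType}.
Context (P : probability T R) (F : subSigmaAlgebra T).
Context (p : \bar R) (p1 : (1 <= p)%E).
Local Notation L0 := {mfun_ P, T >-> R}.
Implicit Types (x y z e r : L0) (A C D H : set T).
Context (B : set L0) (BE : B `<=` condLp F p) (barrelB : L0_barrel F p1 B).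
Context (ccB : countable_concatenation F B).
Local Notation ball := (ballL0 F p).

(* [B (scaleL0 (inv_nat n) y)] says that [y] belongs to [n.+1 B]. *)
Let inv_nat (n : nat) : R := n.+1%:R^-1.

Lemma barrel_mul (g : T -> R) x y : measurable_fun [set: subT F] g ->
  (forall w, `|g w| <= 1) -> B x -> (\forall w \ae P, y w = g w * x w) -> B y.
Proof.
move=> mg g1 Bx yx; have [bal _ _ _] := barrelB.
have gE := L0_ofE P (sub_measurable_fun mg).
suff -> : y = L0_of P g * x.
  apply: bal => //; first exact: F_measurable_L0_of.
  by apply: filterS gE => w ->.
by apply: L0_ae; apply: filterS3 yx gE (mulL0_ae (L0_of P g) x) => w -> <- ->.
Qed.

Lemma barrel_midpoint x y z : B x -> B y ->
  (\forall w \ae P, z w = 2^-1 * (x w + y w)) -> B z.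
Proof.
move=> Bx By zxy; have [_ _ conv _] := barrelB.
have hE : \forall w \ae P, L0_of P (cst 2^-1) w = 2^-1.
  by apply: L0_ofE; exact: measurable_cst.
suff -> : z = L0_of P (cst 2^-1) * x + (1 - L0_of P (cst 2^-1)) * y.
  apply: conv => //; first exact: L0F_cst.
  by apply: filterS hE => w ->; lra.
apply: L0_ae.
set h := L0_of P (cst 2^-1) in hE *.
apply: filterS3 zxy (addL0_ae (h * x) ((1 - h) * y)) (filterI hE (filterI
  (mulL0_ae h x)
  (filterI (mulL0_ae (1 - h) y) (filterI (subL0_ae 1 h) (oneL0_ae P))))).
move=> w -> -> [hw [-> [-> [-> ->]]]]; rewrite hw; lra.
Qed.

Lemma barrel_glue (N : T -> nat) (u : nat -> L0) x : sub_index F N ->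
  (forall n, B (u n)) -> (\forall w \ae P, x w = u (N w) w) -> B x.
Proof.
move=> FN Bu xu.
have [||y By yu] := ccB (A := fun n => N @^-1` [set n]) FN Bu.
- by apply/trivIsetP => i j _ _ ij; rewrite -subset0 => w [/= Ni Nj]; move: ij;
  rewrite -Ni Nj eqxx.
- by apply/seteqP; split => // w _; exists (N w).
suff -> : x = y by [].
apply: L0_ae.
have h : \forall w \ae P, forall n,
    \1_(N @^-1` [set n]) w * y w = \1_(N @^-1` [set n]) w * u n w.
  apply: ae_foralln => n.
  have mN := sub_events_measurable (FN n).
  have := yu n; set I := indL0 _ _ => yun.
  apply: filterS3 (indL0_ae P (sub_events_measurable (FN n))) (mulL0_ae I y)
    (mulL0_ae I (u n)).
  by move=> w; rewrite -/I yun => <- <- ->.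
apply: filterS2 xu h => w -> /(_ (N w)).
by rewrite indicE mem_set// !mul1r.
Qed.

Lemma barrel_ae x y : (\forall w \ae P, x w = y w) -> B x -> B y.
Proof. by move=> /L0_ae ->. Qed.

Lemma barrel0 x : (\forall w \ae P, x w = 0) -> B x.
Proof.
move=> x0; have [_ absorb _ _] := barrelB.
have [xi xi0 xiB] := absorb _ (condLp0 P F p1).
apply: barrel_ae (xiB 0 _ _).
- by apply: filterS3 x0 (mulL0_ae 0 (0 : L0)) (L0_0E P) => w -> -> ->;
  rewrite mulr0.
- by exists (cst 0) => //; apply: filterS (L0_0E P) => w ->.
- by apply: filterS2 xi0.2 (L0_0E P) => w /ltW + ->; rewrite normr0.
Qed.

Lemma barrel_closed y : condLp F p y -> ~ B y ->
  exists2 r, L0F_gt0 F r & forall z, ball (z - y) r -> ~ B z.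
Proof.
move=> Ey nBy; have [_ _ _ clB] := barrelB.
have oB : open (~` @Lp_trace _ _ _ P F p p1 B) by rewrite openC.
have [r r0 rB] := oB (exist _ y (mem_set Ey)) nBy.
exists r => // z zy Bz.
apply: (rB (exist _ z (mem_set (BE Bz)))) => //.
exact: (condnorm_le_as p1 r0 zy).2.
Qed.

(** * The category argument *)

Definition absorbed D := exists2 e, L0F_gt0 F e &
  forall y, ball y e -> B (restrL0 D y).

(** Quantifying over all subsets of positive measure makes this property inherited by F-subsets of
    [D] and stable under gluing, as [F_local] demands. *)
Definition nowhere (n : nat) D z := forall A, F A -> A `<=` D -> P A != 0%E ->
  ~ B (scaleL0 (inv_nat n) (restrL0 A z)).

Lemma inv_nat_gt0 n : 0 < inv_nat n.
Proof. by rewrite invr_gt0. Qed.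

Lemma inv_nat_le1 n : inv_nat n <= 1.
Proof. by rewrite invf_le1 ?ler1n. Qed.

Lemma scale_restrE (c : R) A y : F A ->
  \forall w \ae P, scaleL0 c (restrL0 A y) w = c * (\1_A w * y w).
Proof. by move=> FA; apply:
  filterS2 (scaleL0E c (restrL0 A y)) (restrL0E y FA) => w -> ->. Qed.

Lemma measurable_indic_sub A : F A -> measurable_fun [set: subT F] (\1_A :
  T -> R).
Proof.
by move=> FA; apply: (@measurable_indic _ (subT F)); rewrite subTE.
Qed.

Lemma barrel_scale_restr_sub (n : nat) A C y z : F A -> F C -> C `<=` A ->
  (\forall w \ae P, C w -> y w = z w) ->
  B (scaleL0 (inv_nat n) (restrL0 A y)) -> B (scaleL0 (inv_nat n) (restrL0 C
    z)).
Proof.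
move=> FA FC CA yz BA.
apply: (barrel_mul (measurable_indic_sub FC) _ BA).
  by move=> w; rewrite indicE; case: (_ \in _); rewrite ?normr1 ?normr0.
apply: filterS3 (scale_restrE (inv_nat n) y FA) (scale_restrE (inv_nat n) z FC)
  yz => w -> -> yz.
rewrite !indicE; case: (boolP (w \in C)) => [/set_mem Cw|_];
  last by rewrite !mul0r mulr0.
by rewrite (mem_set (CA _ Cw)) yz// !mul1r.
Qed.

Lemma restr_null A y : F A -> P A = 0%E -> \forall w \ae P, restrL0 A y w = 0.
Proof.
move=> FA PA; apply: filterS2 (restrL0E y FA) (ae_notin (sub_measurable FA) PA)
  => w -> nA.
by rewrite indicE memNset// mul0r.
Qed.

Lemma barrel_scale_restr_glue (n : nat) (N : T -> nat) (u : nat -> L0) z :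
  sub_index F N ->
  (forall m, B (scaleL0 (inv_nat n) (restrL0 (N @^-1` [set m.+1]) (u m)))) ->
  (\forall w \ae P, forall m, N w = m.+1 -> z w = u m w) ->
  B (scaleL0 (inv_nat n) (restrL0 (~` (N @^-1` [set 0%N])) z)).
Proof.
move=> FN Bu zu.
pose v (k : nat) := if k is m.+1 then scaleL0 (inv_nat n) (restrL0 (N @^-1`
  [set m.+1]) (u m)) else (0 : L0).
apply: (@barrel_glue N v) => //.
  by case=> [|m]; [apply: barrel0; exact: L0_0E|exact: Bu].
have vE : \forall w \ae P, forall k, v k w =
    if k is m.+1 then inv_nat n * (\1_(N @^-1` [set m.+1]) w * u m w) else 0.
  apply: ae_foralln => -[|m]; first exact: L0_0E.
  exact: scale_restrE (FN m.+1).
apply: filterS3 (scale_restrE (inv_nat n) z (subC (FN 0%N))) vE zu =>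
  w -> -> zu.
rewrite !indicE in_setC; case Nw : (N w) => [|m].
  by rewrite mem_set// mul0r mulr0.
rewrite (zu m Nw) memNset/=; last by rewrite Nw.
by rewrite indicE mem_set.
Qed.

Lemma absorbed_local : F_local P F absorbed.
Proof.
split.
- move=> A C FA FC CA [e e0 eA]; exists e => // y /eA BA.
  apply: (barrel_mul (measurable_indic_sub FC) _ BA).
    by move=> w; rewrite indicE; case: (_ \in _); rewrite ?normr1 ?normr0.
  apply: filterS2 (restrL0E y FA) (restrL0E y FC) => w -> ->.
  rewrite !indicE; case: (boolP (w \in C)) => [/set_mem Cw|_];
    last by rewrite !mul0r.
  by rewrite (mem_set (CA _ Cw)) !mul1r.
- move=> A FA PA; exists 1; first exact: L0F_gt0_one.
  by move=> y _; apply: barrel0; exact: restr_null.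
- move=> N FN absN.
  have /choice[e eP] n : exists e, L0F_gt0 F e /\
      forall y, ball y e -> B (restrL0 (N @^-1` [set n.+1]) y).
    by have [e e0 eB] := absN n; exists e.
  pose en n : L0 := if n is m.+1 then e m else 1.
  exists (glueL0 N en).
    apply: L0F_gt0_glue => // -[|m]; first exact: L0F_gt0_one.
    by case: (eP m).
  move=> y ye.
  (* The restriction is doubled because the property of block m is applied to [y] cut off outside
     that block: only this element is sure to lie in the ball of radius [e m]. *)
  pose v (k : nat) := if k is m.+1 then restrL0 (N @^-1` [set m.+1]) (restrL0
    (N @^-1` [set m.+1]) y) else (0 : L0).
  apply: (@barrel_glue N v) => //.
    case=> [|m]; first by apply: barrel0; exact: L0_0E.
    have [_ Bm] := eP m; apply: Bm.
    apply: (ballL0_restr p1 (FN m.+1) ye); first exact: restrL0E.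
    by apply: filterS (glueL0E en FN) => w -> /= ->.
  have vE : \forall w \ae P, forall k, v k w =
      if k is m.+1 then \1_(N @^-1` [set m.+1]) w * (\1_(N @^-1` [set m.+1]) w
        * y w) else 0.
    apply: ae_foralln => -[|m]; first exact: L0_0E.
    apply: filterS2 (restrL0E y (FN m.+1)) (restrL0E (restrL0 (N @^-1` [set
      m.+1]) y) (FN m.+1)).
    by move=> w <- ->.
  apply: filterS2 (restrL0E y (subC (FN 0%N))) vE => w -> ->.
  rewrite !indicE in_setC; case Nw : (N w) => [|m].
    by rewrite mem_set// mul0r.
  rewrite memNset/=; last by rewrite Nw.
  by rewrite indicE mem_set// !mul1r.
Qed.

Lemma not_absorbed_point n D x0 r : F D -> ~ absorbed D -> L0F_gt0 F r ->
  exists2 x, ball (x - x0) r & ~ B (scaleL0 (inv_nat n) (restrL0 D x)).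
Proof.
move=> FD nD r0; apply: contrapT => noy.
have BD x : ball (x - x0) r -> B (scaleL0 (inv_nat n) (restrL0 D x)).
  by move=> xr; apply: contrapT => nB; apply: noy; exists x.
(* With radius [r] / n.+1 for [y], the multiple [Y] of [y] by n.+1 keeps [x0 + Y] and [x0 - Y] in
   the ball of radius [r]. The midpoint of (x0 + Y) / n.+1 and -(x0 - Y) / n.+1 is [y]. *)
apply: nD; exists (scaleL0 (inv_nat n) r) => [|y yr].
  by apply: L0F_gt0_scale => //; exact: inv_nat_gt0.
have nz : n.+1%:R != 0 :> R by [].
pose Y : L0 := scaleL0 n.+1%:R y.
have YE : \forall w \ae P, Y w = n.+1%:R * y w := scaleL0E _ _.
have rE : \forall w \ae P, r w = n.+1%:R * scaleL0 (inv_nat n) r w.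
  by apply: filterS (scaleL0E (inv_nat n) r) => w ->;
    rewrite mulrA divff// mul1r.
have BY (s : R) : `|s| = 1 -> B (scaleL0 (inv_nat n) (restrL0 D (x0 + scaleL0 s
  Y))).
  move=> s1; apply: BD.
  have Yr : ball Y r := ballL0_scale p1 yr YE rE.
  apply: (ballL0_trans _ Yr).
  apply: ballL0_ae => //.
  apply: filterS3 (subL0_ae (x0 + scaleL0 s Y) x0) (addL0_ae x0 (scaleL0 s Y))
    (scaleL0E s Y).
  by move=> w -> -> ->; rewrite addrAC subrr add0r normrM s1 mul1r.
have B1 := BY 1 (normr1 _).
have := BY (-1); rewrite normrN1 => /(_ erefl) B2.
have B3 : B (- scaleL0 (inv_nat n) (restrL0 D (x0 + scaleL0 (-1) Y))).
  apply: (@barrel_mul (cst (-1)) _ _ _ _ B2) => //.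
    by move=> w; rewrite normrN1.
  by apply: filterS (oppL0_ae (scaleL0 (inv_nat n) (restrL0 D (x0 + scaleL0
    (-1) Y)))) => w ->; rewrite mulN1r.
apply: (barrel_midpoint B1 B3).
set u := scaleL0 (inv_nat n) _; set v := scaleL0 (inv_nat n) _.
near=> w.
have -> : (- v : L0) w = - v w by near: w; exact: oppL0_ae.
have -> : u w = inv_nat n * (\1_D w * (x0 + scaleL0 1 Y : L0) w).
  by near: w; exact: scale_restrE.
have -> : v w = inv_nat n * (\1_D w * (x0 + scaleL0 (-1) Y : L0) w).
  by near: w; exact: scale_restrE.
have -> : (x0 + scaleL0 1 Y : L0) w = x0 w + scaleL0 1 Y w by near: w; exact:
  addL0_ae.
have -> : (x0 + scaleL0 (-1) Y : L0) w = x0 w + scaleL0 (-1) Y w by near: w;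
  exact: addL0_ae.
have -> : scaleL0 1 Y w = 1 * Y w by near: w; exact: scaleL0E.
have -> : scaleL0 (-1) Y w = -1 * Y w by near: w; exact: scaleL0E.
have -> : Y w = n.+1%:R * y w by near: w; exact: YE.
have -> : restrL0 D y w = \1_D w * y w by near: w; exact: (restrL0E y FD).
by rewrite /inv_nat; field.
Unshelve. all: by end_near. Qed.

(** Cutting off outside [D] and dividing by n.+1 does not increase distances, so the radius given by
    closedness of [B] at the image of [x] serves at [x]. *)
Lemma closed_radius n D x : F D -> condLp F p x ->
  ~ B (scaleL0 (inv_nat n) (restrL0 D x)) ->
  exists2 r, L0F_gt0 F r &
    forall z, ball (z - x) r -> ~ B (scaleL0 (inv_nat n) (restrL0 D z)).
Proof.
move=> FD Ex nB.
have c0 := inv_nat_gt0 n.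
have le1 w (t : R) : `|inv_nat n * (\1_D w * t)| <= `|t|.
  rewrite mulrA normrM ler_piMl// normrM mulr_ile1// ?(gtr0_norm c0)
    ?inv_nat_le1//.
  by rewrite indicE; case: (_ \in _); rewrite ?normr1 ?normr0.
have Ey : condLp F p (scaleL0 (inv_nat n) (restrL0 D x)).
  by apply: (condLp_solid p1 Ex); apply:
    filterS (scale_restrE (inv_nat n) x FD) => w ->.
have [r r0 rB] := barrel_closed Ey nB.
exists r => // z zr; apply: rB.
apply: (ballL0_trans _ zr); apply: ballL0_ae => //.
set u := scaleL0 _ _; set v := scaleL0 _ _.
apply: filterS2 (subL0_ae u v) (filterI (subL0_ae z x) (filterI (scale_restrE
  (inv_nat n) x FD)
  (scale_restrE (inv_nat n) z FD))) => w -> [-> [-> ->]].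
by rewrite -!mulrBr.
Qed.

(** Otherwise every part of [D] of positive measure would contain a smaller one over which some
    point of the ball is in n.+1 B. Balls are stable under gluing, so these points would yield a
    single one for all of [D]. *)
Lemma exists_nowhere n D x r : F D ->
  (forall z, ball (z - x) r -> ~ B (scaleL0 (inv_nat n) (restrL0 D z))) ->
  exists C, [/\ F C, C `<=` D, P C != 0%E &
    forall z, ball (z - x) r -> nowhere n C z].
Proof.
move=> FD nD; apply: contrapT => noC.
suff [z zr Bz] : exists2 z, ball (z - x) r & B (scaleL0 (inv_nat n) (restrL0 D
  z)).
  exact: nD zr Bz.
pose Q S := exists2 z, ball (z - x) r & B (scaleL0 (inv_nat n) (restrL0 S z)).
have ball0 : ball (x - x) r.
  apply: ballL0_ae => //; apply: filterS (subL0_ae x x) => w ->.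
  by rewrite subrr normr0.
apply: (@local_to_global _ _ _ P F Q) => //.
- split.
  + move=> A C FA FC CA [z zr BA]; exists z => //.
    by apply: barrel_scale_restr_sub BA => //; exact: aeW.
  + move=> A FA PA; exists x => //; apply: barrel0.
    apply: filterS2 (scaleL0E (inv_nat n) (restrL0 A x)) (restr_null x FA PA)
      => w -> ->.
    by rewrite mulr0.
  + move=> N FN QN; have /choice[z zP] m : exists z, ball (z - x) r /\
        B (scaleL0 (inv_nat n) (restrL0 (N @^-1` [set m.+1]) z)).
      by have [z zr Bz] := QN m; exists z.
    pose zn m := if m is k.+1 then z k else x.
    have zE := glueL0E zn FN.
    exists (glueL0 N zn).
      apply: (ballL0_glue p1 (u := fun m => zn m - x) (e := fun=> r) FN) => //.
      * by case=> [|m]//; case: (zP m).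
      * have h : \forall w \ae P, forall m, (zn m - x : L0) w = zn m w - x w.
          by apply: ae_foralln => m; exact: subL0_ae.
        by apply: filterS3 zE h (subL0_ae (glueL0 N zn) x) => w zw h ->;
          rewrite h zw.
      * exact: aeW.
    apply: (barrel_scale_restr_glue FN (u := z)); first by move=> m; case:
      (zP m).
    by apply: filterS zE => w -> m ->.
- move=> D' FD' D'D PD'; apply: contrapT => noC'; apply: noC.
  exists D'; split => // z zr A FA AD' PA BA; apply: noC'.
  by exists A; split => //; exists z.
Qed.

(** On each part of [H] of positive measure, a point outside n.+1 B, the closedness radius around it
    and [exists_nowhere] give a centre and a radius that work over a smaller set. Exhaustion glues
    these centres and radii into one pair for [H]. *)
Lemma escape n H x0 r : F H ->
  (forall A, F A -> A `<=` H -> P A != 0%E -> ~ absorbed A) ->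
  condLp F p x0 -> L0F_gt0 F r ->
  exists x r', [/\ L0F_gt0 F r', ball (x - x0) r &
    forall z, ball (z - x) r' -> nowhere n H z].
Proof.
move=> FH nH Ex0 r0.
have ball0 e : ball (x0 - x0) e.
  apply: ballL0_ae => //; apply: filterS (subL0_ae x0 x0) => w ->.
  by rewrite subrr normr0.
pose Q C := exists x r', [/\ L0F_gt0 F r', ball (x - x0) r &
    forall z, ball (z - x) r' -> nowhere n C z].
apply: (@local_to_global _ _ _ P F Q) => //.
- split.
  + move=> A C FA FC CA [x [r' [r'0 xr xn]]]; exists x, r'; split => // z zx.
    by move=> A' FA' A'C; apply: (xn z zx) => //; exact: subset_trans CA.
  + move=> A FA PA; exists x0, 1; split => //; first exact: L0F_gt0_one.
    move=> z _ A' FA' A'A /negP PA'; exfalso; apply: PA'.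
    by apply/eqP; apply: (subset_measure0 (sub_measurable FA') (sub_measurable
      FA) A'A).
  + move=> N FN QN; have /choice[xr xrP] m : exists s : L0 * L0,
        [/\ L0F_gt0 F s.2, ball (s.1 - x0) r &
        forall z, ball (z - s.1) s.2 -> nowhere n (N @^-1` [set m.+1]) z].
      by have [x [r' h]] := QN m; exists (x, r').
    pose xn m := if m is k.+1 then (xr k).1 else x0.
    pose rn m : L0 := if m is k.+1 then (xr k).2 else 1.
    have xE := glueL0E xn FN.
    have rE := glueL0E rn FN.
    exists (glueL0 N xn), (glueL0 N rn); split.
    * by apply: L0F_gt0_glue => // -[|m]; [exact: L0F_gt0_one|case: (xrP m)].
    * apply: (ballL0_glue p1 (u := fun m => xn m - x0) (e := fun=> r) FN) => //.
      - by case=> [|m]//; case: (xrP m).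
      - have h : \forall w \ae P, forall m, (xn m - x0 : L0) w = xn m w - x0 w.
          by apply: ae_foralln => m; exact: subL0_ae.
        by apply: filterS3 xE h (subL0_ae (glueL0 N xn) x0) => w zw h ->;
          rewrite h zw.
      - exact: aeW.
    move=> z zr A FA AN PA BA.
    have PAm : exists m, P (A `&` N @^-1` [set m.+1]) != 0%E.
      apply: contrapT => noM; move/negP: PA; apply; apply/eqP.
      apply: notin_ae; first exact: (sub_measurable FA).
      have : \forall w \ae P, forall m, ~ (A `&` N @^-1` [set m.+1]) w.
        apply: ae_foralln => m; apply: ae_notin.
          exact: sub_measurable (subI FA (FN m.+1)).
        by apply: contrapT => /eqP PAm; apply: noM; exists m.
      apply: filterS => w nA Aw; case Nw : (N w) => [|m]; first exact: AN Aw Nw.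
      exact: nA m (conj Aw Nw).
    have [m PAm'] := PAm.
    have FNm := FN m.+1.
    have [_ _ xn_] := xrP m.
    (* A point [z] close to the glued centre is close to the centre of block m on that block only.
       Adding [u] to the latter centre gives an element that equals [z] on block m and the centre
       elsewhere, hence lies in the ball of block m. *)
    pose u : L0 := restrL0 (N @^-1` [set m.+1]) (z - glueL0 N xn).
    have uE : \forall w \ae P, u w = \1_(N @^-1` [set m.+1]) w * (z - glueL0 N
      xn : L0) w.
      exact: restrL0E.
    apply: (xn_ ((xr m).1 + u) _ (A `&` N @^-1` [set m.+1]) _ _ PAm').
    * apply: (ballL0_restr p1 FNm zr).
        apply: filterS3 (subL0_ae ((xr m).1 + u) (xr m).1) (addL0_ae (xr m).1
          u) uE.
        by move=> w -> -> ->; rewrite addrAC subrr add0r.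
      by apply: filterS rE => w -> /= ->.
    * exact: subI.
    * exact: subIsetr.
    * apply: barrel_scale_restr_sub BA => //; first exact: subI.
      apply: filterS3 (addL0_ae (xr m).1 u) uE (filterI (subL0_ae z (glueL0 N
        xn)) xE).
      move=> w -> -> [-> ->] [_ Nw]; rewrite indicE mem_set// mul1r.
      by rewrite (_ : N w = m.+1)//= addrC subrK.
- move=> D FD DH PD; have nD := nH D FD DH PD.
  have [x xr nBx] := not_absorbed_point n x0 FD nD r0.
  have Ex : condLp F p x.
    apply: (condLp_ballL0 p1 Ex0 r0 xr).
    by apply: filterS (subL0_ae x x0) => w ->; rewrite addrC subrK.
  have [r' r'0 nD'] := closed_radius FD Ex nBx.
  have [C [FC CD PC nC]] := exists_nowhere FD nD'.
  by exists C; split => //; exists x, r'.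
Qed.

Lemma barrel_absorbs_ball : absorbed [set: T].
Proof.
apply: contrapT => nT.
have [H [FH PH nH]] : exists H, [/\ F H, P H != 0%E &
    forall A, F A -> A `<=` H -> P A != 0%E -> ~ absorbed A].
  apply: contrapT => noH; apply: nT.
  apply: (local_to_global absorbed_local (sub_eventsT F)) => D FD _ PD.
  apply: contrapT => noC; apply: noH; exists D; split => // A FA AD PA absA.
  by apply: noC; exists A.
(* The fraction of the radius that [condnorm_complete] allows for the n-th step. *)
pose delta n r : L0 := scaleL0 (4 ^ n.+1)%:R^-1 r.
(* The invariants are premises, and the state is left unchanged when they fail, so that [f] is total
   and can be iterated. *)
have /choice[f fP] (ns : nat * (L0 * L0)) : exists s' : L0 * L0,
    condLp F p ns.2.1 -> L0F_gt0 F ns.2.2 ->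
    [/\ condLp F p s'.1 /\ L0F_gt0 F s'.2, \forall w \ae P, s'.2 w <= ns.2.2 w,
      ball (s'.1 - ns.2.1) (delta ns.1 ns.2.2) &
      forall z, ball (z - s'.1) s'.2 -> nowhere ns.1 H z].
  case: ns => n [x r] /=.
  have [Ex|?] := pselect (condLp F p x); last by exists (x, r).
  have [r0|?] := pselect (L0F_gt0 F r); last by exists (x, r).
  have d0 : L0F_gt0 F (delta n r).
    by apply: L0F_gt0_scale => //; rewrite invr_gt0 ltr0n expn_gt0.
  have [x' [r1 [r10 xx' nx']]] := escape n FH nH Ex d0.
  (* The minimum with [r] makes the sequence of radii decreasing. *)
  have [r' r'0 r'r] := L0F_gt0_min r10 r0.
  exists (x', r') => _ _; split => //=.
  - split => //; apply: (condLp_ballL0 p1 Ex d0 xx').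
    by apply: filterS (subL0_ae x' x) => w ->; rewrite addrC subrK.
  - by apply: filterS r'r => w [].
  - move=> z zx'; apply: nx'; apply: (ballL0_trans zx'); apply: ballL0_ae => //.
    apply: filterS3 r'r r'0.2 r10.2 => w [h _] h1 h2.
    by rewrite !gtr0_norm.
pose s := fix s n : L0 * L0 := if n is m.+1 then f (m, s m) else (0, 1).
have s0 n : condLp F p (s n).1 /\ L0F_gt0 F (s n).2.
  elim: n => [|n [Ex r0]]; first by split; [exact: condLp0|exact: L0F_gt0_one].
  by have [] := fP (n, s n) Ex r0.
have sP n := fP (n, s n) (s0 n).1 (s0 n).2.
have p0 : (0 <= p)%E by exact: le_trans p1.
have mB (x y : L0) : measurable_fun [set: T] (fun w => x w - y w).
  by apply: measurable_funB; exact: measurable_L0.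
have [z zP] : exists z : L0, forall n,
    condnorm_le P F p (fun w => z w - (s n).1 w) (s n).2.
  apply: (condnorm_complete (x := fun n => (s n).1) p1).
  - by move=> n; case: (s0 n).
  - by move=> n; case: (sP n).
  - move=> n; have [_ _ + _] := sP n; set x' := (f _).1 => xx'.
    have mc : measurable_fun [set: T] (fun w => (4 ^ n.+1)%:R^-1 * (s n).2 w).
      by apply: measurable_funM => //; exact: measurable_L0.
    apply: (condnorm_le_trans (y := (x' - (s n).1 : L0))).
      apply: (condnorm_le_ae _ p0 (mB _ _) (measurable_L0 _)).
      by apply: filterS (subL0_ae x' (s n).1) => w ->.
    apply: (condnorm_le_trans xx').
    apply: (condnorm_le_ae _ p0 (measurable_L0 _) mc).
    by apply: filterS (scaleL0E (4 ^ n.+1)%:R^-1 (s n).2) => w ->.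
have zball n : ball (z - (s n).1) (s n).2.
  apply: (condnorm_le_trans _ (zP n)).
  apply: (condnorm_le_ae _ p0 (measurable_L0 _) (mB _ _)).
  by apply: filterS (subL0_ae z (s n).1) => w ->.
(* The ball of index n.+1 was chosen at stage n, to avoid n.+1 B. *)
have nz n : nowhere n H z by have [_ _ _] := sP n; apply; exact: (zball n.+1).
have Ez : condLp F p z.
  apply: (condLp_ballL0 p1 (s0 0%N).1 (s0 0%N).2 (zball 0%N)).
  by apply: filterS (subL0_ae z (s 0%N).1) => w ->; rewrite addrC subrK.
have [_ absorb _ _] := barrelB.
have [xi xi0 xiB] := absorb _ Ez.
have [g [mg g0 xig]] := L0F_gt0_pos_rep xi0.
(* As [xi] is positive, these sets cover [H] up to a null set, so one of them has positive measure.
   There the multiplier 1 / n.+1 is at most [xi], which puts [z] in n.+1 B over [A n]. *)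
pose A n := H `&` [set w | inv_nat n <= g w].
have FA n : F (A n).
  apply: subI => //; rewrite -subTE -[X in measurable X]setTI.
  exact: measurable_fun_le.
have [n PAn] : exists n, P (A n) != 0%E.
  apply: contrapT => noM; move/negP: PH; apply; apply/eqP.
  apply: notin_ae; first exact: (sub_measurable FH).
  have : \forall w \ae P, forall n, ~ A n w.
    apply: ae_foralln => n; apply: ae_notin; first exact:
      (sub_measurable (FA n)).
    by apply: contrapT => /eqP PAm; apply: noM; exists n.
  apply: filterS => w nA Hw.
  have [n] := ltr_add_invr (g0 w); rewrite add0r => /ltW gn.
  exact: nA n (conj Hw gn).
apply: (nz n _ (FA n) (@subIsetl _ _ _) PAn).
have mA : measurable_fun [set: subT F] (fun w => inv_nat n * \1_(A n) w).
  by apply: measurable_funM => //; exact: measurable_indic_sub.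
have AE := L0_ofE P (sub_measurable_fun mA).
apply: (barrel_ae _ (xiB (L0_of P (fun w => inv_nat n * \1_(A n) w)) _ _)).
- apply: filterS3 (mulL0_ae (L0_of P (fun w =>
  inv_nat n * \1_(A n) w)) z) AE (scale_restrE (inv_nat n) z (FA n)).
  by move=> w -> -> ->; rewrite mulrA.
- exact: F_measurable_L0_of.
- apply: filterS2 AE xig => w -> ->;
  rewrite normrM (gtr0_norm (inv_nat_gt0 n)) indicE.
  case: (boolP (w \in A n)) => [/set_mem[_ ?]|_]; first by rewrite normr1 mulr1.
  by rewrite normr0 mulr0 ltW.
Qed.

Lemma barrel_nbhs : nbhs (Lp0 P F p1) (@Lp_trace _ _ _ P F p p1 B).
Proof.
have [e e0 eB] := barrel_absorbs_ball.
(* A neighborhood has to contain an open set, and openness is defined through balls around each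
   point. [U] is the candidate for the interior of [B]; it is open because two steps of radius [r] /
   16 stay within radius [r] by [ballL0_add]. *)
pose U : set (LpType P F p1) := [set x | exists2 r, L0F_gt0 F r &
  forall y : L0, ball (y - Lp_val x) r -> B y].
have ball0 x r : ball (x - x) r.
  apply: ballL0_ae => //; apply: filterS (subL0_ae x x) => w ->.
  by rewrite subrr normr0.
have oU : open U.
  move=> x [r r0 rB].
  have d0 : L0F_gt0 F (scaleL0 16^-1 r) by apply: L0F_gt0_scale => //;
    rewrite invr_gt0.
  exists (scaleL0 16^-1 r) => // y xy; exists (scaleL0 16^-1 r) => // z yz.
  have {}xy := le_as_condnorm p1 d0 xy.
  apply: rB; apply: (ballL0_add p1 xy yz).
    set u := Lp_val x; set v := Lp_val y.
    apply: filterS3 (subL0_ae z u) (subL0_ae z v) (subL0_ae v u) => w -> -> ->.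
    by lra.
  by apply: filterS (scaleL0E 16^-1 r) => w ->.
have U0 : U (Lp0 P F p1).
  exists e => // y ye.
  have : B (restrL0 setT y).
    apply: eB; apply: (ballL0_trans _ ye); apply: ballL0_ae => //.
    apply: filterS2 (subL0_ae y (Lp_val (Lp0 P F p1))) (L0_0E P) => w -> ->.
    by rewrite subr0.
  apply: barrel_ae; apply: filterS (restrL0E y (sub_eventsT F)) => w ->.
  by rewrite indicT mul1r.
have : nbhs (Lp0 P F p1) U by exact: open_nbhs_nbhs.
by apply: filterS => x [r r0]; apply.
Qed.

End barrel.

Local Open Scope ereal_scope.

Theorem corollary3p28 (R : realType) (d : measure_display)
  (T : measurableType d) (P : probability T R) (F : subSigmaAlgebra T)
  (p : \bar R) (p1 : 1 <= p) :
  L0_pre_barreled P F p1.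
Proof. by move=> B BE barrelB ccB; exact: barrel_nbhs. Qed.
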